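(* Let $\Phi=\{\phi_n:n\in\mathbb N\}$ be an infinite autonomous conformal iterated function system on $X$. Let $\sigma:\mathbb N^{\mathbb N}\to\mathbb N^{\mathbb N}$ be the shift, $\sigma(\omega)_n=\omega_{n+1}$, and let \[I^\infty_{\mathrm{dense}}=\{\omega\in\mathbb N^{\mathbb N}:\{\sigma^n(\omega):n\ge0\}\text{ is dense in }\mathbb N^{\mathbb N}\},\] where $\mathbb N^{\mathbb N}$ carries the product topology. Set $J_{\mathrm{dense}}(\Phi)=\pi_\Phi(I^\infty_{\mathrm{dense}})$. Then \[\operatorname{HD}(J_{\mathrm{dense}}(\Phi))=\operatorname{HD}(J(\Phi)).\]
   Context: Fix $d\in\mathbb N$ and a compact set $X\subset\mathbb R^d$ equal to the closure of its interior, with $\partial X$ smooth or $X$ convex. An infinite autonomous conformal iterated function system is a family $\{\phi_n:X\to X\}_{n\in\mathbb N}$ such that: - the sets $\phi_a(\operatorname{int}X)$, $a\in\mathbb N$, are pairwise disjoint; - all $\phi_n$ extend to $C^1$ conformal diffeomorphisms of a common open connected $V\supset X$ into $V$; - there is $K\ge1$ with $|\phi'(x)|\le K|\phi'(y)|$ for $x,y\in V$ and every finite composition $\phi$ of the maps; - $\sup_{x\in X}|\phi_n'(x)|\le\eta<1$ for all $n$. (Equivalently, it is an NCIFS with $I^{(j)}=\mathbb N$ and $\Phi^{(j)}=\Phi$ for all $j$.) For $\omega\in\mathbb N^{\mathbb N}$ put $\phi_{\omega|_n}=\phi_{\omega_1}\circ\cdots\circ\phi_{\omega_n}$. The projection $\pi_\Phi(\omega)$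 is the unique point of $\bigcap_{n\ge1}\phi_{\omega|_n}(X)$. The limit set is $J(\Phi)=\bigcap_n\bigcup_{\omega\in\mathbb N^n}\phi_\omega(X)=\pi_\Phi(\mathbb N^{\mathbb N})$. $\operatorname{HD}$ is Hausdorff dimension. *)

(* Defs.v *)
From HB Require Import structures.
From mathcomp Require Import all_boot all_order all_algebra.
From mathcomp Require Import all_classical all_reals all_analysis.
Set Implicit Arguments. Unset Strict Implicit. Unset Printing Implicit Defensive.
Import Order.TTheory GRing.Theory Num.Theory.
Import numFieldNormedType.Exports.
Local Open Scope classical_set_scope.
Local Open Scope ring_scope.

Section Defs.
Variables (R : realType) (d : nat).
Notation V := 'rV[R]_d.

Definition enorm (v : V) : R := Num.sqrt (\sum_(i < d) v ord0 i ^+ 2).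

(* Euclidean diameter (sup of the empty set is 0) *)
Definition ediam (U : set V) : R := sup [set enorm (x - y) | x in U & y in U].

Definition diam_le (U : set V) (delta : R) : Prop :=
  forall x y, U x -> U y -> enorm (x - y) <= delta.

Definition hausdorff_pre (s delta : R) (A : set V) : \bar R :=
  ereal_inf [set (\sum_(i <oo) ((ediam (U i)) `^ s)%:E)%E
            | U in [set U : nat -> set V |
                     A `<=` \bigcup_i U i /\ forall i, diam_le (U i) delta]].

Definition hausdorff_measure (s : R) (A : set V) : \bar R :=
  ereal_sup [set hausdorff_pre s delta A | delta in [set delta : R | 0 < delta]].

Definition hausdorff_dim (A : set V) : \bar R :=
  ereal_inf [set s%:E | s in [set s : R | 0 <= s /\ hausdorff_measure s A = 0%E]].

Definition dnorm (f : V -> V) (x : V) : R :=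
  sup [set enorm ('d f x v) | v in [set v : V | enorm v <= 1]].

Definition conformal_diffeo_on (W : set V) (f : V -> V) : Prop :=
  [/\ f @` W `<=` W,
      {in W &, injective f},
      (forall x, W x -> differentiable f x),
      (forall x, W x -> forall v, {for x, continuous (fun y => 'd f y v)}) &
      (forall x, W x -> exists2 lam : R, 0 < lam &
          forall v, enorm ('d f x v) = lam * enorm v)].

Fixpoint dd (vs : seq V) (g : V -> R) : V -> R :=
  if vs is v :: vs' then 'D_v (dd vs' g) else g.

Definition smooth_boundary (X : set V) : Prop :=
  forall p, (closure X `\` interior X) p ->
    exists2 r : R, 0 < r & exists g : V -> R,
      [/\ (forall vs v x, ball p r x -> derivable (dd vs g) x v),
          (forall vs x, ball p r x -> {for x, continuous (dd vs g)}),
          (forall x, ball p r x -> exists v, 'D_v g x != 0) &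
          X `&` ball p r = [set x | ball p r x /\ g x <= 0]].

Definition convex_set (X : set V) : Prop :=
  forall x y (t : R), X x -> X y -> 0 <= t <= 1 -> X (t *: x + (1 - t) *: y).

Definition word_comp (phi : nat -> V -> V) (w : seq nat) : V -> V :=
  foldr (fun a f => phi a \o f) id w.

Definition CIFS (X : set V) (phi : nat -> V -> V) : Prop :=
  [/\ compact X /\ X = closure (interior X),
      smooth_boundary X \/ convex_set X,
      (forall n, phi n @` X `<=` X) /\
      (forall a b, a <> b -> (phi a @` interior X) `&` (phi b @` interior X) = set0),
      (exists W : set V, [/\ open W, connected W, X `<=` W,
          (forall n, conformal_diffeo_on W (phi n)) &
          (exists2 K : R, 1 <= K & forall w x y, W x -> W y ->
             dnorm (word_comp phi w) x <= K * dnorm (word_comp phi w) y)]) &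
      (exists2 eta : R, eta < 1 & forall n x, X x -> dnorm (phi n) x <= eta)].

(* x = pi_Phi(omega): x lies in every phi_{omega|_n}(X) *)
Definition is_proj (X : set V) (phi : nat -> V -> V) (om : nat -> nat) (x : V) :=
  forall n, (word_comp phi [seq om i | i <- iota 0 n] @` X) x.

Definition limit_set (X : set V) (phi : nat -> V -> V) : set V :=
  [set x | forall n, exists2 w : seq nat, size w = n & (word_comp phi w @` X) x].

End Defs.

Definition shift (om : {ptws nat -> nat}) : {ptws nat -> nat} := fun k => om k.+1.

Definition I_dense : set {ptws nat -> nat} :=
  [set om | dense (range (fun n => iter n shift om))].

Definition J_dense (R : realType) (d : nat) (X : set 'rV[R]_d)
  (phi : nat -> 'rV[R]_d -> 'rV[R]_d) : set 'rV[R]_d :=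
  [set x | exists2 om, I_dense om & is_proj X phi om x].

(* Main.v *)
Require Import Defs.
From HB Require Import structures.
From mathcomp Require Import all_boot all_order all_algebra.
From mathcomp Require Import all_classical all_reals all_analysis.
From mathcomp Require Import ring lra.
Set Implicit Arguments. Unset Strict Implicit. Unset Printing Implicit Defensive.
Import Order.TTheory GRing.Theory Num.Theory.
Import numFieldNormedType.Exports.
Local Open Scope classical_set_scope.
Local Open Scope ring_scope.

(** Write a w = |phi_w'(x0)| for a fixed interior point x0 of X. If for some t
    the sums of a w ^ t over the words of length n were bounded uniformly in n,
    the covers of the limit set by the sets phi_w(X), |w| = n, would show that
    its dimension is at most t. So for 0 < t < HD(J) some finite set F of words
    of equal length has a sum exceeding 4 K ^ t, K being the distortion constant.

    Concatenate blocks from F, inserting all finite words u_0, u_1, ... one after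
    the other: every resulting sequence has a dense orbit. Give a block e in F the
    probability proportional to a e ^ t. Each F-step divides the ratio
    mass / a w ^ t by at least 4, so that if each insertion is delayed long enough,
    the loss it causes, including the loss due to the jump in scale, stays
    summable. Disjointness of the phi_w(int X) bounds the number of pieces of a
    given size meeting a set of that size, so a set of diameter at most r has mass
    O(r ^ t), and the t-dimensional Hausdorff measure of J_dense is positive. *)

(** * Euclidean norm *)

Section EuclideanNorm.
Variables (R : realType) (d : nat).
Implicit Types (u v w x y : 'rV[R]_d) (e : R).

Lemma enorm_ge0 v : 0 <= enorm v.
Proof. exact: sqrtr_ge0. Qed.

Lemma enorm_sqr v : enorm v ^+ 2 = \sum_(i < d) v ord0 i ^+ 2.
Proof. by rewrite /enorm sqr_sqrtr// sumr_ge0// => i _; rewrite sqr_ge0. Qed.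

Lemma enormZ (a : R) v : enorm (a *: v) = `|a| * enorm v.
Proof.
apply/eqP; rewrite -(@eqrXn2 _ 2)// ?mulr_ge0// ?enorm_ge0//.
rewrite exprMn !enorm_sqr real_normK ?num_real// mulr_sumr.
by apply/eqP/eq_bigr => i _; rewrite mxE exprMn.
Qed.

Lemma enorm0 : enorm (0 : 'rV[R]_d) = 0.
Proof. by rewrite -(scale0r (0 : 'rV[R]_d)) enormZ normr0 mul0r. Qed.

Lemma enormN v : enorm (- v) = enorm v.
Proof. by rewrite -scaleN1r enormZ normrN1 mul1r. Qed.

Lemma enormC u v : enorm (u - v) = enorm (v - u).
Proof. by rewrite -enormN opprB. Qed.

Lemma enorm_coord v i : `|v ord0 i| <= enorm v.
Proof.
rewrite -(@ler_pXn2r _ 2)// ?nnegrE ?enorm_ge0// real_normK ?num_real//.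
by rewrite enorm_sqr (bigD1 i)//= lerDl sumr_ge0// => j _; rewrite sqr_ge0.
Qed.

Lemma enorm_eq0 v : enorm v = 0 -> v = 0.
Proof.
move=> v0; apply/rowP => i; rewrite mxE; apply/eqP; rewrite -normr_le0 -v0.
exact: enorm_coord.
Qed.

Lemma ler_enormD u v : enorm (u + v) <= enorm u + enorm v.
Proof.
have [/enorm_eq0 ->|v0] := eqVneq (enorm v) 0.
  by rewrite addr0 enorm0 addr0.
rewrite -(@ler_pXn2r _ 2)// ?nnegrE ?addr_ge0 ?enorm_ge0//.
have v2 : 0 < enorm v by rewrite lt_neqAle eq_sym v0 enorm_ge0.
pose D := \sum_(i < d) u ord0 i * v ord0 i.
have Dq (a b : R) : enorm (a *: u + b *: v) ^+ 2
    = a ^+ 2 * enorm u ^+ 2 + 2 * a * b * D + b ^+ 2 * enorm v ^+ 2.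
  rewrite !enorm_sqr /D !mulr_sumr -!big_split/=; apply: eq_bigr => i _.
  by rewrite !mxE; ring.
have := Dq 1 1; rewrite !scale1r => ->.
(* Cauchy-Schwarz: the squared norm of this vector is |v|^2 (|u|^2 |v|^2 - D^2). *)
have := sqr_ge0 (enorm ((enorm v ^+ 2) *: u + (- D) *: v)).
rewrite Dq => h.
have {}h : D ^+ 2 <= (enorm u * enorm v) ^+ 2.
  rewrite -subr_ge0 -(pmulr_lge0 _ (exprn_gt0 2 v2)).
  by apply: le_trans h _; rewrite le_eqVlt; apply/orP; left; apply/eqP; ring.
have {}h : D <= enorm u * enorm v.
  apply: le_trans (ler_norm D) _; rewrite -(@ler_pXn2r _ 2)// ?nnegrE//.
    by rewrite real_normK ?num_real.
  by rewrite mulr_ge0 ?enorm_ge0.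
nra.
Qed.

Lemma ler_enorm_dist x y z : enorm (x - z) <= enorm (x - y) + enorm (y - z).
Proof. by rewrite -[x - z](subrKA y) ler_enormD. Qed.

Lemma ler_dist_enorm u v : `|enorm u - enorm v| <= enorm (u - v).
Proof.
rewrite ler_norml; apply/andP; split.
  by have := ler_enormD (v - u) u; rewrite subrK enormC; lra.
by have := ler_enormD (u - v) v; rewrite subrK; lra.
Qed.

Lemma norm_coord v i : `|v ord0 i| <= `|v|.
Proof.
by rewrite [leRHS]/Num.norm/= mx_normrE; apply/bigmax_geP; right; exists (ord0, i).
Qed.

Lemma norm_le_enorm v : `|v| <= enorm v.
Proof.
rewrite [leLHS]/Num.norm/= mx_normrE; apply/bigmax_leP; split; first exact: enorm_ge0.
by move=> [i j] _ /=; rewrite ord1 enorm_coord.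
Qed.

Lemma enorm_le_norm v : enorm v <= d%:R * `|v|.
Proof.
rewrite -(@ler_pXn2r _ 2)// ?nnegrE ?enorm_ge0 ?mulr_ge0//.
rewrite enorm_sqr exprMn; apply: (@le_trans _ _ (\sum_(i < d) `|v| ^+ 2)).
  apply: ler_sum => i _; rewrite -[leLHS]real_normK ?num_real//.
  by rewrite ler_pXn2r ?nnegrE// norm_coord.
rewrite sumr_const card_ord -[leLHS]mulr_natl ler_wpM2r ?sqr_ge0//.
by rewrite -natrX ler_nat; case: (d) => // n; rewrite expnS expn1 leq_pmulr.
Qed.

Lemma nbhs_enormP (x : 'rV[R]_d) (A : set 'rV[R]_d) :
  nbhs x A <-> exists2 e, 0 < e & forall y, enorm (y - x) < e -> A y.
Proof.
split=> [/nbhs_ballP[e /= e0 eA]|[e e0 eA]].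
  exists e => // y yx; apply: eA; rewrite mx_norm_ball /ball_ /= distrC.
  exact: le_lt_trans (norm_le_enorm _) yx.
(* The comparison constant is [d]; dividing by [d.+1] keeps the divisor positive also when
   [d = 0]. *)
apply/nbhs_ballP; exists (e / d.+1%:R); first by rewrite /= divr_gt0.
move=> y; rewrite mx_norm_ball /ball_ /= distrC => xy; apply: eA.
apply: le_lt_trans (enorm_le_norm _) _.
rewrite ltr_pdivlMr ?ltr0n// in xy; apply: le_lt_trans xy.
by rewrite mulrC ler_wpM2l// ler_nat.
Qed.

Lemma enorm_dist_continuous (T : topologicalType) (f : T -> 'rV[R]_d) p t :
  {for t, continuous f} -> {for t, continuous (fun s => enorm (f s - p))}.
Proof.
move=> ft; apply/(@cvgrPdist_le _ _ _ (nbhs t) (nbhs_filter t)) => e e0.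
have : nbhs (f t) [set y | enorm (y - f t) < e] by apply/nbhs_enormP; exists e.
move=> /ft; apply: (@filterS _ (nbhs t) (nbhs_filter t)) => s /= fs.
apply: le_trans (ler_dist_enorm _ _) _.
by rewrite opprB addrA subrK enormC ltW.
Qed.

(** The little-o of the derivative is measured in the maximum norm; passing to the Euclidean norm
    costs a factor at most [d], absorbed by shrinking [e]. *)
Lemma differentiable_enorm (f : 'rV[R]_d -> 'rV[R]_d) x : differentiable f x ->
  forall e, 0 < e -> exists2 del, 0 < del & forall h, enorm h < del ->
    enorm (f (x + h) - f x - 'd f x h) <= e * enorm h.
Proof.
move=> df e e0; have := diff_locally df.
set o := (X in _ + X); move=> fE.
have e1 : 0 < e / d.+1%:R by rewrite divr_gt0.
have /eqoP /(_ _ e1) : o =o_ (nbhs (0 : 'rV[R]_d)) id by rewrite /o.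
move=> /nbhs_enormP[del del0 delP].
exists del => // h hdel; have := delP h; rewrite subr0 => /(_ hdel) => oh.
have -> : f (x + h) - f x - 'd f x h = o h.
  have /= := congr1 (@^~ h) fE; rewrite [x + h]addrC => ->.
  by rewrite !fctE -(addrA _ (- f x)) -opprD addrC addKr.
apply: le_trans (enorm_le_norm _) _.
have := norm_le_enorm h => nh.
apply: le_trans (_ : d.+1%:R * (e / d.+1%:R * `|h|) <= _).
  by apply: ler_pM => //; rewrite ler_nat.
by rewrite mulrA mulrCA divff// mulr1 ler_wpM2l// ltW.
Qed.

End EuclideanNorm.

(** * Maps whose derivative is a similarity *)

Section SimilarityDerivative.
Variables (R : realType) (d : nat).
Implicit Types (f : 'rV[R]_d -> 'rV[R]_d) (a b p x y : 'rV[R]_d).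

(** Scaling norms by [l > 0] forces a trivial kernel, hence invertibility in finite dimension. *)
Lemma similarity_surjective (L : {linear 'rV[R]_d -> 'rV[R]_d}) (l : R) :
  0 < l -> (forall v, enorm (L v) = l * enorm v) -> forall y, exists v, L v = y.
Proof.
move=> l0 Ll y; have Lunit : lin1_mx L \in unitmx.
  rewrite -row_free_unit -kermx_eq0; apply/eqP/row_matrixP => i; rewrite row0.
  apply: enorm_eq0; apply/eqP.
  have := Ll (row i (kermx (lin1_mx L))).
  rewrite -mul_rV_lin1 -row_mul mulmx_ker row0 enorm0 => /esym/eqP.
  by rewrite mulf_eq0 gt_eqF.
by exists (y *m invmx (lin1_mx L)); rewrite -mul_rV_lin1 mulmxKV.
Qed.

Lemma compact_enorm_ball p (rho : R) : compact [set x | enorm (x - p) <= rho].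
Proof.
apply: bounded_closed_compact.
  exists (enorm p + rho); split; first exact: num_real.
  move=> M pM x /= xp; apply: le_trans (norm_le_enorm _) _.
  by have := ler_enormD (x - p) p; rewrite subrK; lra.
rewrite (_ : [set _ | _] = (fun x => enorm (x - p)) @^-1` [set r | r <= rho])//.
apply: closed_comp; last exact: closed_le.
by move=> x _; apply: (@enorm_dist_continuous _ _ _ id); exact: cvg_id.
Qed.

(* Minimise |f x - y| + m |x - p| over the ball, with m < lam; at an interior
   point with f x <> y, moving along v with 'd f x v = y - f x decreases it. *)
Lemma ball_sub_image f p (rho lam : R) y : 0 < rho -> 0 < lam ->
  (forall x, enorm (x - p) <= rho -> differentiable f x /\
    exists2 l, lam <= l & forall v, enorm ('d f x v) = l * enorm v) ->
  enorm (y - f p) < lam * rho -> exists2 x, enorm (x - p) < rho & f x = y.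
Proof.
move=> rho0 lam0 df yfp.
(* Above |y - f p| / rho, [m] keeps the minimiser off the boundary sphere; below [lam], it lets the
   move along [v] lower [h]. *)
pose m := (enorm (y - f p) / rho + lam) / 2.
have ylam : enorm (y - f p) / rho < lam by rewrite ltr_pdivrMr.
have y0 : 0 <= enorm (y - f p) / rho by rewrite divr_ge0 ?enorm_ge0// ltW.
have m0 : 0 < m by rewrite /m; lra.
have mlam : m < lam by rewrite /m; lra.
have ym : enorm (y - f p) < m * rho by rewrite -ltr_pdivrMr// /m; lra.
pose K := [set x | enorm (x - p) <= rho].
pose h x := enorm (f x - y) + m * enorm (x - p).
have Kp : K p by rewrite /K/= subrr enorm0 ltW.
have hK : {within K, continuous h}.
  apply: continuous_in_subspaceT => x /set_mem Kx.
  apply: (@cvgD _ _ _ (nbhs x) (nbhs_filter x)).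
    apply: (@enorm_dist_continuous _ _ _ f).
    by apply: differentiable_continuous; case: (df x Kx).
  apply: (@cvgM _ _ (nbhs x) (nbhs_filter x)); first exact: cvg_cst.
  by apply: (@enorm_dist_continuous _ _ _ id); exact: cvg_id.
have [|c /set_mem Kc cmin] := compact_EVT_min _ (@compact_enorm_ball p rho) hK.
  by exists p.
have cp : enorm (c - p) < rho.
  have := cmin p (mem_set Kp).
  rewrite /h subrr enorm0 mulr0 addr0 (enormC (f p)) => hc.
  by rewrite -(ltr_pM2l m0); have := enorm_ge0 (f c - y); lra.
exists c => //; apply/eqP; rewrite -subr_eq0; apply/negP => fcy.
have [dfc [l laml dfl]] := df c Kc.
have l0 : 0 < l by lra.
have [v Lv] := similarity_surjective l0 dfl (y - f c).
pose e := enorm (f c - y).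
have e0 : 0 < e.
  rewrite lt_neqAle enorm_ge0 andbT eq_sym; apply/eqP => /enorm_eq0.
  by apply/eqP; apply/negP.
have ev : e = l * enorm v by rewrite -dfl Lv enormC.
have v0 : 0 < enorm v by rewrite ev in e0; rewrite -(pmulr_rgt0 _ l0).
have eps0 : 0 < (lam - m) / 2 by lra.
have [del del0 fdel] := differentiable_enorm dfc eps0.
pose n := Num.min 1 (Num.min del (rho - enorm (c - p))).
have n0 : 0 < n by rewrite !lt_min ltr01 del0 subr_gt0 cp.
have [n1 ndel nrho] : [/\ n <= 1, n <= del & n <= rho - enorm (c - p)].
  by rewrite !ge_min !lexx !orbT.
(* With t + t |v| = [n], both [t <= 1] and the bounds on the displacement t |v| follow at once. *)
pose t := n / (1 + enorm v).
have t0 : 0 < t by rewrite divr_gt0// addr_gt0.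
have tE : t + t * enorm v = n by rewrite /t; field; lra.
have tv0 : 0 < t * enorm v by rewrite mulr_gt0.
have etv : enorm (t *: v) = t * enorm v by rewrite enormZ gtr0_norm.
have := cmin (c + t *: v).
have Kt : K (c + t *: v).
  rewrite /K/= addrAC; apply: le_trans (ler_enormD _ _) _; rewrite etv; lra.
move=> /(_ (mem_set Kt)); apply/negP; rewrite -ltNge /h.
have h1 : enorm (c + t *: v - p) <= enorm (c - p) + t * enorm v.
  by rewrite addrAC -etv ler_enormD.
have h2 : enorm (f (c + t *: v) - y) <= (1 - t) * e + (lam - m) / 2 * (t * enorm v).
  have := fdel (t *: v); rewrite etv => /(_ ltac:(lra)).
  rewrite linearZ/= Lv => h2.
  have -> : f (c + t *: v) - y = (1 - t) *: (f c - y) +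
      (f (c + t *: v) - f c - t *: (y - f c)).
    by apply/rowP => i; rewrite !mxE; ring.
  apply: le_trans (ler_enormD _ _) _; rewrite enormZ ger0_norm; last lra.
  by rewrite lerD2l.
have h3 : m * enorm (c + t *: v - p) <= m * enorm (c - p) + m * (t * enorm v).
  by rewrite -mulrDr ler_pM2l.
have h4 : lam * (t * enorm v) <= t * e.
  by rewrite ev (mulrCA t) ler_pM2r.
have h5 : m * (t * enorm v) < lam * (t * enorm v) by rewrite ltr_pM2r.
rewrite -/e; move: h2 h3 h4 h5.
move: (t * enorm v) => T; lra.
Qed.

(* At a maximum c < 1 of (M + e) t |b - a| - |f (a + t (b - a)) - f a|, moving
   to the right would increase the function. *)
Lemma segment_lipschitz f a b (M : R) :
  (forall t, 0 <= t <= 1 -> differentiable f (a + t *: (b - a)) /\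
    forall v, enorm ('d f (a + t *: (b - a)) v) <= M * enorm v) ->
  enorm (f b - f a) <= M * enorm (b - a).
Proof.
move=> df; have [/enorm_eq0 /subr0_eq ->|ba0] := eqVneq (enorm (b - a)) 0.
  by rewrite !subrr enorm0 mulr0.
have {}ba0 : 0 < enorm (b - a) by rewrite lt_neqAle eq_sym ba0 enorm_ge0.
rewrite -ler_pdivrMr//; apply/ler_addgt0Pr => e e0; rewrite ler_pdivrMr//.
pose c_ t := a + t *: (b - a).
pose g t := (M + e) * (t * enorm (b - a)) - enorm (f (c_ t) - f a).
have gc : {within `[0, 1], continuous g}.
  apply: continuous_in_subspaceT => t /set_mem/=; rewrite in_itv/= => t01.
  apply: cvgB.
    apply: cvgM; first exact: cvg_cst.
    by apply: cvgM; [exact: cvg_id|exact: cvg_cst].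
  apply: (@enorm_dist_continuous _ _ _ (f \o c_)).
  apply: (@continuous_comp _ _ _ c_ f).
    apply: cvgD; first exact: cvg_cst.
    exact: scalel_continuous.
  by apply: differentiable_continuous; case: (df t t01).
have [c + cmax] := EVT_max ler01 gc; rewrite in_itv/= => /andP[c0 c1].
(* If the maximum is at [c = 1], then [g 1 >= g 0 = 0], which is the claim. *)
have [c1'|c1'] := leP 1 c.
  have := cmax 0; rewrite in_itv/= lexx ler01 => /(_ isT).
  have -> : c = 1 by lra.
  rewrite /g /c_ scale0r addr0 subrr enorm0 scale1r subrKC; lra.
have e2 : 0 < e / 2 by lra.
have [|dfc dfM] := df c; first by rewrite c0.
have [del del0 fdel] := differentiable_enorm dfc e2.
pose s := Num.min (1 - c) (del / 2 / enorm (b - a)).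
have s0 : 0 < s by rewrite lt_min subr_gt0 c1'/= !divr_gt0.
have [s1 s2] : s <= 1 - c /\ s * enorm (b - a) <= del / 2.
  by rewrite -ler_pdivlMr// !ge_min !lexx orbT.
have esba : enorm (s *: (b - a)) = s * enorm (b - a) by rewrite enormZ gtr0_norm.
have sba : 0 < s * enorm (b - a) by rewrite mulr_gt0.
have := fdel (s *: (b - a)); rewrite esba => /(_ ltac:(lra)) h.
have := cmax (c + s); rewrite in_itv/= => /(_ ltac:(apply/andP; split; lra)).
rewrite /g; set F := f (c_ (c + s)).
have cE : c_ c + s *: (b - a) = c_ (c + s) by rewrite /c_ scalerDl addrA.
have {}h : enorm (F - f (c_ c)) <= (M + e / 2) * (s * enorm (b - a)).
  rewrite mulrDl; have := dfM (s *: (b - a)); rewrite esba => h'.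
  have := ler_enormD (F - f (c_ c) - 'd f (c_ c) (s *: (b - a)))
    ('d f (c_ c) (s *: (b - a))).
  rewrite subrK => h2; apply: le_trans h2 _; rewrite addrC lerD//.
  by rewrite /F -cE.
have := ler_enorm_dist F (f (c_ c)) (f a).
move: h sba; rewrite (mulrDl c); move: (s * enorm (b - a)) => S h S0 h1 h2.
have : 0 < e * S by rewrite mulr_gt0.
move: h h1 h2; rewrite !mulrDl !mulrDr; lra.
Qed.

End SimilarityDerivative.

(** * Conformal systems *)

Lemma word_comp_cat (R : realType) (d : nat) (phi : nat -> 'rV[R]_d -> 'rV[R]_d) u v x :
  word_comp phi (u ++ v) x = word_comp phi u (word_comp phi v x).
Proof. by elim: u => //= n u ->. Qed.

Section ConformalSystem.
Variables (R : realType) (d : nat).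
Notation V := 'rV[R]_d.

(* a w stands for |phi_w'(x0)|, with x0 a fixed interior point of X. *)
Record coded_system (X : set V) (phi : nat -> V -> V) (x0 : V)
    (a : seq nat -> R) (K eta C c : R) : Prop := CodedSystem {
  coded_base : X x0;
  coded_compact : compact X;
  coded_stable : forall w x, X x -> X (word_comp phi w x);
  coded_closed : forall w, closed (word_comp phi w @` X);
  coded_nil : a [::] = 1;
  coded_pos : forall w, 0 < a w;
  coded_K : 1 <= K;
  coded_leM : forall u v, a (u ++ v) <= K * (a u * a v);
  coded_geM : forall u v, a u * a v <= K * a (u ++ v);
  coded_eta0 : 0 < eta;
  coded_eta1 : eta < 1;
  coded_contract : forall w, a w <= eta ^+ size w;
  coded_C0 : 0 < C;
  coded_diam : forall w x y, X x -> X y ->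
    enorm (word_comp phi w x - word_comp phi w y) <= C * a w;
  coded_c0 : 0 < c;
  coded_sep : forall w w', size w = size w' -> w <> w' ->
    c * a w <= enorm (word_comp phi w x0 - word_comp phi w' x0) }.

(** The supremum is attained at a coordinate unit vector, which exists because [0 < d]. *)
Lemma dnorm_similarity (f : V -> V) x (l : R) : (0 < d)%N -> 0 <= l ->
  (forall v, enorm ('d f x v) = l * enorm v) -> dnorm f x = l.
Proof.
move=> d0 l0 fl; pose i := Ordinal d0.
have e1 : enorm (delta_mx ord0 i : V) = 1.
  apply/eqP; rewrite -(@eqrXn2 _ 2)// ?enorm_ge0// enorm_sqr expr1n.
  rewrite (bigD1 i)//= mxE !eqxx expr1n big1 ?addr0// => j ji.
  by rewrite mxE (negbTE ji) andbF expr0n.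
have lub : ubound [set enorm ('d f x v) | v in [set v : V | enorm v <= 1]] l.
  by move=> _ /= [v v1 <-]; rewrite fl ler_piMr.
have lin : [set enorm ('d f x v) | v in [set v : V | enorm v <= 1]] l.
  by exists (delta_mx ord0 i); rewrite /= ?e1// fl e1 mulr1.
apply/eqP; rewrite eq_le; apply/andP; split.
  by apply: ge_sup => //; exists l.
by apply: ub_le_sup => //; exists l.
Qed.

Variables (X W : set V) (phi : nat -> V -> V) (K : R).
Hypotheses (d_gt0 : (0 < d)%N) (Wopen : open W)
  (Wconf : forall n, conformal_diffeo_on W (phi n)).

Lemma word_comp_similarity w x : W x -> [/\ W (word_comp phi w x),
  differentiable (word_comp phi w) x, 0 < dnorm (word_comp phi w) x &
  forall v, enorm ('d (word_comp phi w) x v) = dnorm (word_comp phi w) x * enorm v].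
Proof.
move=> Wx; suff [Ww dw [l l0 dl]] : [/\ W (word_comp phi w x),
    differentiable (word_comp phi w) x &
    exists2 l, 0 < l & forall v, enorm ('d (word_comp phi w) x v) = l * enorm v].
  by rewrite (dnorm_similarity d_gt0 (ltW l0) dl).
elim: w => [|n w [Ww dw [l l0 dl]]].
  split=> //; exists 1 => // v.
  have E := @diff_val _ _ _ _ _ _ _ (is_diff_id x).
  by rewrite mul1r -[v in RHS]/(id v) -E.
have [WW _ Wd _ Wsim] := Wconf n; split.
- by apply: WW; exists (word_comp phi w x).
- by apply: differentiable_comp => //; exact: Wd.
- have [l' l'0 dl'] := Wsim _ Ww; exists (l' * l); first exact: mulr_gt0.
  have E : 'd (word_comp phi (n :: w)) x =
      'd (phi n) (word_comp phi w x) \o 'd (word_comp phi w) x :> (V -> V).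
    exact: diff_comp dw (Wd _ Ww).
  by move=> v; rewrite E /= dl' dl mulrA.
Qed.

Lemma dnorm_word_comp_cat u v x : W x -> dnorm (word_comp phi (u ++ v)) x =
  dnorm (word_comp phi u) (word_comp phi v x) * dnorm (word_comp phi v) x.
Proof.
move=> Wx; have [Wv dv pv sv] := word_comp_similarity v Wx.
have [Wu du pu su] := word_comp_similarity u Wv.
apply: (dnorm_similarity d_gt0); first exact: mulr_ge0 (ltW pu) (ltW pv).
have -> : word_comp phi (u ++ v) = word_comp phi u \o word_comp phi v.
  by apply/funext => z; exact: word_comp_cat.
have E : 'd (word_comp phi u \o word_comp phi v) x =
    'd (word_comp phi u) (word_comp phi v x) \o 'd (word_comp phi v) x :> (V -> V).
  exact: diff_comp dv du.
by move=> y; rewrite E /= su sv mulrA.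
Qed.

Hypothesis (Wdist : forall w x y, W x -> W y ->
  dnorm (word_comp phi w) x <= K * dnorm (word_comp phi w) y).
Hypothesis (K1 : 1 <= K).

(** Bounded distortion keeps the scaling factor on the whole ball above 1/K times its value at [p],
    so [ball_sub_image] applies with the same constants for all words. *)
Lemma word_comp_ball_sub_image w p (rho : R) y : 0 < rho ->
  (forall x, enorm (x - p) <= rho -> W x) ->
  enorm (y - word_comp phi w p) < K^-1 * dnorm (word_comp phi w) p * rho ->
  exists2 x, enorm (x - p) < rho & word_comp phi w x = y.
Proof.
move=> rho0 pW; have Wp : W p by apply: pW; rewrite subrr enorm0 ltW.
have K0 : 0 < K := lt_le_trans ltr01 K1.
apply: ball_sub_image => //.
  by rewrite mulr_gt0 ?invr_gt0//; case: (word_comp_similarity w Wp).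
move=> x /pW Wx; have [_ dw p0 dl] := word_comp_similarity w Wx; split=> //.
by exists (dnorm (word_comp phi w) x) => //; rewrite ler_pdivrMl// Wdist.
Qed.

Hypotheses (XW : X `<=` W) (phiX : forall n, phi n @` X `<=` X).

Lemma word_comp_stable w x : X x -> X (word_comp phi w x).
Proof.
move=> Xx; elim: w => //= n w IH.
by apply: (phiX (n := n)); exists (word_comp phi w x).
Qed.

Lemma interior_enorm x : interior X x ->
  exists2 rho, 0 < rho & forall y, enorm (y - x) <= rho -> interior X y.
Proof.
move=> Xx; have : nbhs x (interior X) by exact: nbhs_interior.
move=> /nbhs_enormP[e e0 eX]; exists (e / 2); first lra.
by move=> y yx; apply: eX; lra.
Qed.

Lemma word_comp_interior w x : interior X x -> interior X (word_comp phi w x).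
Proof.
move=> iXx; have [rho rho0 rhoX] := interior_enorm iXx.
have Wx : W x by apply: XW; exact: interior_subset.
apply/nbhs_enormP; exists (K^-1 * dnorm (word_comp phi w) x * rho).
  have [_ _ p0 _] := word_comp_similarity w Wx.
  by rewrite !mulr_gt0 ?invr_gt0// (lt_le_trans ltr01).
move=> y /word_comp_ball_sub_image[]// => [z /rhoX /interior_subset /XW//|z zx <-].
by apply: word_comp_stable; apply: interior_subset; apply: rhoX; exact: ltW.
Qed.

Hypothesis (phidisj : forall m n, m <> n ->
  (phi m @` interior X) `&` (phi n @` interior X) = set0).

(** Common initial letters are cancelled by injectivity on [W]; words of equal length then differ at
    some letter, where [phidisj] applies. *)
Lemma word_comp_disjoint w w' x x' : size w = size w' -> w <> w' ->
  interior X x -> interior X x' -> word_comp phi w x <> word_comp phi w' x'.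
Proof.
elim: w w' => [|m w IH] [|n w']//= [sw] mw iXx iXx'.
have iw := word_comp_interior w iXx; have iw' := word_comp_interior w' iXx'.
have [mn|/eqP mn] := eqVneq m n; last first.
  move=> E; have := phidisj mn; rewrite -subset0 => /(_ (phi m (word_comp phi w x))).
  apply; split; first by exists (word_comp phi w x).
  by exists (word_comp phi w' x') => //; exact/esym.
rewrite -mn in mw *; have [_ inj _ _ _] := Wconf m => /inj.
have XiW y : interior X y -> y \in W.
  by move=> /interior_subset /XW Wy; exact/mem_set.
move=> /(_ (XiW _ iw) (XiW _ iw')); apply: IH => // E.
by apply: mw; rewrite E.
Qed.

Hypotheses (Wconn : connected W) (Xcomp : compact X).

(** The radius [e] depends on [y] only: a ball inside [W] contains the segments from its centre, and
    distortion bounds the derivatives of all words on them. *)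
Lemma word_comp_local_lipschitz x0 y : W x0 -> W y -> exists2 e, 0 < e &
  forall z, enorm (z - y) < e -> W z /\ forall w,
  enorm (word_comp phi w z - word_comp phi w y)
    <= K * dnorm (word_comp phi w) x0 * e.
Proof.
move=> Wx0 Wy; have : nbhs y W by apply: open_nbhs_nbhs.
move=> /nbhs_enormP[e e0 eW]; exists e => // z zy; split=> [|w]; first exact: eW.
have a0 : 0 < K * dnorm (word_comp phi w) x0.
  have [_ _ p0 _] := word_comp_similarity w Wx0.
  by rewrite mulr_gt0// (lt_le_trans ltr01).
apply: le_trans (_ : K * dnorm (word_comp phi w) x0 * enorm (z - y) <= _).
  apply: segment_lipschitz => t /andP[t0 t1].
  have Wt : W (y + t *: (z - y)).
    apply: eW; rewrite addrAC subrr add0r enormZ ger0_norm//.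
    by apply: le_lt_trans zy; rewrite ler_piMl// enorm_ge0.
  have [_ dw _ dl] := word_comp_similarity w Wt; split=> // v.
  by rewrite dl ler_wpM2r ?enorm_ge0// Wdist.
by rewrite ler_pM2l// ltW.
Qed.

(** Segments between points of [X] may leave [W], so the bound spreads by connectedness: the points
    of [W] whose images stay, for all [w], within a fixed multiple of |phi_w'(x0)| from the image of
    [x0] form a nonempty relatively clopen set. Compactness of [X] makes the multiple uniform. *)
Lemma word_comp_diam x0 : X x0 -> exists2 C, 0 < C & forall w x y, X x -> X y ->
  enorm (word_comp phi w x - word_comp phi w y) <= C * dnorm (word_comp phi w) x0.
Proof.
move=> Xx0; have Wx0 := XW Xx0.
have a0 w : 0 < dnorm (word_comp phi w) x0 by case: (word_comp_similarity w Wx0).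
pose P (L : R) y := forall w, enorm (word_comp phi w y - word_comp phi w x0)
  <= L * dnorm (word_comp phi w) x0.
(* The first implication makes the set of good points open, the second its complement in [W]. *)
have Ploc y : W y -> exists2 e, 0 < e & forall z, enorm (z - y) < e -> W z /\
    forall L, (P L y -> P (L + K * e) z) /\ (P L z -> P (L + K * e) y).
  move=> Wy; have [e e0 eL] := word_comp_local_lipschitz Wx0 Wy.
  exists e => // z /eL[Wz zL]; split=> // L; split=> PL w; rewrite mulrDl [leRHS]addrC.
    apply: le_trans (ler_enorm_dist _ (word_comp phi w y) _) _.
    by rewrite lerD// mulrAC.
  apply: le_trans (ler_enorm_dist _ (word_comp phi w z) _) _.
  by rewrite lerD// mulrAC enormC.
have PW : W `&` [set y | exists L, P L y] = W.
  apply: Wconn.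
  - by exists x0; split=> //; exists 0 => w; rewrite subrr enorm0 mul0r.
  - exists (W `&` [set y | exists L, P L y]); last by rewrite setIA setIid.
    rewrite openE => y [Wy [L PL]]; have [e e0 eP] := Ploc y Wy.
    apply/nbhs_enormP; exists e => // z /eP[Wz zP]; split=> //.
    by exists (L + K * e); apply (zP L).1.
  - exists (~` (W `&` [set y | ~ exists L, P L y])).
      apply: open_closedC; rewrite openE => y [Wy PL].
      have [e e0 eP] := Ploc y Wy.
      apply/nbhs_enormP; exists e => // z /eP[Wz zP]; split=> // -[L PLz].
      by apply: PL; exists (L + K * e); apply (zP L).2.
    apply/seteqP; split=> y [Wy Py]; split=> //; first by move=> [].
    by apply: contrapT => nPy; apply: Py.
have : exists L, X `<=` P L.
  have Pmon L L' y : L <= L' -> P L y -> P L' y.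
    by move=> LL' PL w; apply: le_trans (PL w) _; rewrite ler_pM2r.
  have [|N _ NP] := (compact_near_coveringP X).1 Xcomp nat \oo (fun n => P n%:R) _.
    move=> x Xx; have Wx := XW Xx; have [_ [L PL]] : (W `&` [set y | exists L, P L y]) x.
      by rewrite PW.
    have [e e0 eP] := Ploc x Wx; pose m := Num.bound `|L + K * e|.
    have Lm : L + K * e < m%:R := le_lt_trans (ler_norm _) (archi_boundP (normr_ge0 _)).
    exists ([set z | enorm (z - x) < e], [set n | (m <= n)%N]); first split=> /=.
    - by apply/nbhs_enormP; exists e.
    - by exists m.
    move=> [z n] [/= /eP[_ zP] mn]; apply: Pmon ((zP L).1 PL).
    by apply: ltW; apply: lt_le_trans Lm _; rewrite ler_nat.
  by exists N%:R; apply: NP => /=.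
move=> [L XP]; exists (2 * `|L| + 1) => [|w x y Xx Xy]; first by have := normr_ge0 L; lra.
apply: le_trans (ler_enorm_dist _ (word_comp phi w x0) _) _.
have := XP x Xx w; have := XP y Xy w; rewrite (enormC (word_comp phi w y)).
have : L * dnorm (word_comp phi w) x0 <= `|L| * dnorm (word_comp phi w) x0.
  by rewrite ler_pM2r// ler_norm.
by have := a0 w; lra.
Qed.

End ConformalSystem.

(** Distils the geometry into inequalities for |phi_w'(x0)|; derivatives do not reappear
    afterwards. *)
Lemma CIFS_coded_system (R : realType) (d : nat) (X : set 'rV[R]_d)
    (phi : nat -> 'rV[R]_d -> 'rV[R]_d) : CIFS X phi -> X !=set0 ->
  exists x0 a K eta C c, coded_system X phi x0 a K eta C c.
Proof.
move=> [[Xcomp XE] _ [phiX phidisj] [W [Wo Wc XW Wconf [K K1 Wdist]]]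
  [eta eta1 phieta]] [x Xx].
have [x0 iX0] : interior X !=set0.
  have : closure (interior X) x by rewrite -XE.
  move=> /(_ setT (@filterT _ (nbhs x) (nbhs_filter x)))[y [iXy _]].
  by exists y.
have Xx0 : X x0 by exact: interior_subset.
have Wx0 := XW _ Xx0.
(* In dimension 0 all points coincide, so the images of the nonempty interior under two maps could
   not be disjoint. *)
have d0 : (0 < d)%N.
  rewrite lt0n; apply/eqP => d0.
  have : (phi 0%N @` interior X `&` phi 1%N @` interior X) (phi 0%N x0).
    split; first by exists x0.
    exists x0 => //; apply/rowP => i; exfalso.
    by move: i; rewrite d0 => -[].
  by rewrite (phidisj 0%N 1%N).
have sim := word_comp_similarity d0 Wconf.
have apos w : 0 < dnorm (word_comp phi w) x0 by case: (sim w x0 Wx0).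
have K0 : 0 < K := lt_le_trans ltr01 K1.
have stab := word_comp_stable phiX.
have [C C0 diamC] := word_comp_diam d0 Wo Wconf Wdist K1 XW Wc Xcomp Xx0.
have [rho rho0 rhoX] := interior_enorm iX0.
have anil : dnorm (word_comp phi [::]) x0 = 1.
  apply: (mulIf (lt0r_neq0 (apos [::]))); rewrite mul1r; apply: esym.
  exact: (dnorm_word_comp_cat d0 Wconf [::] [::] Wx0).
have acat u v := dnorm_word_comp_cat d0 Wconf u v Wx0.
have eta0 : 0 < eta.
  by apply: lt_le_trans (apos [:: 0%N]) _; exact: phieta.
exists x0, (fun w => dnorm (word_comp phi w) x0), K, eta, C, (K^-1 * rho).
split.
- exact: Xx0.
- exact: Xcomp.
- exact: stab.
- move=> w; apply: compact_closed; first exact: norm_hausdorff.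
  apply: continuous_compact => //; apply: continuous_in_subspaceT => y /set_mem Xy.
  by apply: differentiable_continuous; case: (sim w y (XW _ Xy)).
- exact: anil.
- exact: apos.
- exact: K1.
- move=> u v; rewrite acat mulrA ler_pM2r//.
  by apply: Wdist => //; apply: XW; exact: stab.
- move=> u v; rewrite acat mulrA ler_pM2r//.
  by apply: Wdist => //; apply: XW; exact: stab.
- exact: eta0.
- exact: eta1.
- elim=> [|n w IH]; first by rewrite anil expr0.
  rewrite (acat [:: n] w) exprS; apply: ler_pM => //.
  - by apply: ltW; case: (sim [:: n] (word_comp phi w x0) (XW _ (stab w _ Xx0))).
  - exact: ltW (apos w).
  - by apply: phieta; exact: stab.
- exact: C0.
- exact: diamC.
- by rewrite mulr_gt0 ?invr_gt0.
(* A point phi_w'(x0) closer than this would lie in the image under [w] of the [rho]-ball about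
   [x0], against disjointness. *)
- move=> w w' sw ww'; rewrite leNgt; apply/negP => H.
  have := word_comp_ball_sub_image d0 Wconf Wdist K1 rho0
    (fun y yr => XW _ (interior_subset (rhoX y yr))) (w := w) (y := word_comp phi w' x0).
  rewrite enormC mulrAC => /(_ H)[y /ltW /rhoX iXy].
  exact: (word_comp_disjoint d0 Wconf Wdist K1 XW phiX phidisj sw ww' iXy iX0).
Qed.

(** * Hausdorff dimension and the upper bound *)

Section HausdorffDimension.
Variables (R : realType) (d : nat).
Implicit Types (A B : set 'rV[R]_d) (s t : R).

Lemma small_expr (q e : R) : 0 <= q < 1 -> 0 < e ->
  exists N, forall n, (N <= n)%N -> q ^+ n <= e.
Proof.
move=> /andP[q0 q1] e0.
have /cvgrPdist_le /(_ e e0) : q ^+ n @[n --> \oo] --> 0.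
  by apply: cvg_expr; rewrite ger0_norm.
move=> [N _ Nq]; exists N => n /Nq; rewrite /= sub0r normrN.
by apply: le_trans; exact: ler_norm.
Qed.

Lemma hausdorff_pre_ge0 s delta A : (0 <= hausdorff_pre s delta A)%E.
Proof.
apply: le_ereal_inf_tmp => _ [U _ <-]; apply: nneseries_ge0 => i _ _.
by rewrite lee_fin powR_ge0.
Qed.

Lemma hausdorff_pre_le s delta A B : A `<=` B ->
  (hausdorff_pre s delta A <= hausdorff_pre s delta B)%E.
Proof.
move=> AB; apply: le_ereal_inf => _ [U [BU Ud] <-].
by exists U => //; split=> //; exact: subset_trans BU.
Qed.

Lemma hausdorff_measure_eq0P s A : hausdorff_measure s A = 0%E <->
  forall delta, 0 < delta -> (hausdorff_pre s delta A <= 0)%E.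
Proof.
split=> [A0 delta d0|A0].
  by rewrite -A0; apply: ereal_sup_ubound; exists delta.
apply/eqP; rewrite eq_le; apply/andP; split.
  by apply: ge_ereal_sup => _ [delta /= d0 <-]; exact: A0.
apply: le_trans (hausdorff_pre_ge0 s 1 A) _.
by apply: ereal_sup_ubound; exists 1 => //=.
Qed.

Lemma hausdorff_dim_le A B : A `<=` B -> (hausdorff_dim A <= hausdorff_dim B)%E.
Proof.
move=> AB; apply: le_ereal_inf => _ [s [s0 /hausdorff_measure_eq0P B0] <-].
exists s => //; split=> //; apply/hausdorff_measure_eq0P => delta d0.
exact: le_trans (hausdorff_pre_le _ _ AB) (B0 _ d0).
Qed.

Lemma ediam_set0 : ediam (set0 : set 'rV[R]_d) = 0.
Proof.
rewrite /ediam (_ : [set _ | _ in _ & _ in _] = set0) ?sup0//.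
by rewrite -subset0 => _ [x []].
Qed.

Lemma ediam_le A (r : R) : 0 <= r -> diam_le A r -> ediam A <= r.
Proof.
move=> r0 Ar; have [->|/set0P[x Ax]] := eqVneq A set0.
  by rewrite ediam_set0.
apply: ge_sup; first by exists (enorm (x - x)), x => //; exists x.
by move=> _ [y Ay [z Az <-]]; exact: Ar.
Qed.

Lemma ediam_ge0 A : 0 <= ediam A.
Proof.
rewrite /ediam; have [hs|nhs] := pselect (has_sup [set enorm (x - y) | x in A & y in A]).
  have [[z Sz] ub] := hs; apply: (@le_trans _ _ z); last exact: ub_le_sup.
  by case: Sz => x _ [y _ <-]; exact: enorm_ge0.
by rewrite sup_out.
Qed.

(** The zeroth power of 0 is 1, so the first set of any cover already contributes 1, even if it is
    empty. Hence only positive exponents compete in [hausdorff_dim]. *)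
Lemma hausdorff_measure_exponent0 A : hausdorff_measure 0 A <> 0%E.
Proof.
move=> /hausdorff_measure_eq0P /(_ 1 ltr01); apply/negP; rewrite -ltNge.
apply: lt_le_trans (_ : 1%:E <= _)%E; first by rewrite lte_fin.
apply: le_ereal_inf_tmp => _ [U _ <-].
have := @nneseries_lim_ge R (fun i => (ediam (U i) `^ 0)%:E) xpredT 0%N 1%N.
rewrite big_nat1 powRr0; apply => i _ _.
by rewrite lee_fin powR_ge0.
Qed.

(** Boundedness makes [ediam] a true supremum; an unbounded set would get the default value 0. *)
Lemma enorm_le_ediam (U : set 'rV[R]_d) (r : R) x y : diam_le U r -> U x -> U y ->
  enorm (x - y) <= ediam U.
Proof.
move=> Ur Ux Uy; apply: ub_le_sup; last by exists x => //; exists y.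
by exists r => _ [x' Ux' [y' Uy' <-]]; exact: Ur.
Qed.

Variables (X : set 'rV[R]_d) (phi : nat -> 'rV[R]_d -> 'rV[R]_d) (x0 : 'rV[R]_d).
Variables (a : seq nat -> R) (K eta C c : R).
Hypothesis (cs : coded_system X phi x0 a K eta C c).

(* The sets phi_w(X), |w| = n, cover the limit set for every single n. *)
Lemma limit_set_cover_le n (delta s M : R) : 0 < s -> C * eta ^+ n <= delta ->
  (forall F : seq (seq nat), uniq F -> (forall w, w \in F -> size w = n) ->
    \sum_(w <- F) (C * a w) `^ s <= M) ->
  (hausdorff_pre s delta (limit_set X phi) <= M%:E)%E.
Proof.
move=> s0 Cdelta FM.
(* Words are enumerated by their codes; every other index gets the empty set, whose term vanishes
   because [0 < s]. *)
pose U i := if (pickle_inv i : option (seq nat)) is Some w then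
  if size w == n then word_comp phi w @` X else set0 else set0.
have Udiam w : diam_le (word_comp phi w @` X) (C * a w).
  by move=> _ _ [x Xx <-] [y Xy <-]; exact: (coded_diam cs).
have Ca w : 0 <= C * a w.
  exact: mulr_ge0 (ltW (coded_C0 cs)) (ltW (coded_pos cs w)).
apply: (@le_trans _ _ (\sum_(i <oo) ((ediam (U i)) `^ s)%:E)%E).
  apply: ereal_inf_lbound; exists U => //; split=> [x /(_ n)[w sw wx]|i].
    by exists (pickle w) => //; rewrite /U pickleK_inv sw eqxx.
  rewrite /U; case: (pickle_inv i) => [w|]; last by move=> x y [].
  case: eqP => [sw|_]; last by move=> x y [].
  move=> x y Ux Uy.
  apply: le_trans (Udiam w x y Ux Uy) (le_trans _ Cdelta).
  by rewrite ler_pM2l ?(coded_C0 cs)// -sw (coded_contract cs).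
apply: lime_le.
  by apply: is_cvg_nneseries => i _ _; rewrite lee_fin powR_ge0.
apply: nearW => m; rewrite sumEFin lee_fin.
pose r := iota 0 m; pose F := [seq w <- pmap (@pickle_inv (seq nat)) r | size w == n].
apply: le_trans (FM F _ _); last first.
- by move=> w; rewrite mem_filter => /andP[/eqP].
- by rewrite filter_uniq// (pmap_uniq (@pickle_invK _))// iota_uniq.
rewrite big_mkord -(big_mkord xpredT (fun i => ediam (U i) `^ s)) /index_iota subn0 -/r.
rewrite /F {F}; elim: r => [|i r IH]; first by rewrite /= !big_nil.
rewrite big_cons /= {1}/U; case: (pickle_inv i) => [w|]/=; last first.
  by rewrite ediam_set0 powR0 ?gt_eqF// add0r.
case: ifP => sw; last by rewrite ediam_set0 powR0 ?gt_eqF// add0r.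
rewrite big_cons lerD// ge0_ler_powR ?nnegrE ?ediam_ge0 ?(ltW s0)//.
exact: ediam_le (Udiam w).
Qed.

(** At exponent [t + e] the sum over words of length [n] gains the factor (eta^e)^n, which tends to
    0. *)
Lemma limit_set_dim_le (t B : R) : 0 < t ->
  (forall n (F : seq (seq nat)), (0 < n)%N -> uniq F ->
    (forall w, w \in F -> size w = n) -> \sum_(w <- F) a w `^ t <= B) ->
  (hausdorff_dim (limit_set X phi) <= t%:E)%E.
Proof.
move=> t0 FB; apply/lee_addgt0Pr => e e0; rewrite -EFinD.
pose s := t + e; have s0 : 0 < s by rewrite addr_gt0.
apply: ereal_inf_lbound; exists s => //; split; first exact: ltW.
apply/hausdorff_measure_eq0P => delta delta0.
apply/lee_addgt0Pr => eps eps0; rewrite add0e.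
have [[C0 eta0] eta1] := (coded_C0 cs, coded_eta0 cs, coded_eta1 cs).
have B0 : 0 <= B by have := FB 1%N [::] isT isT; rewrite big_nil; apply.
have [N1 N1P] := small_expr (q := eta) (e := delta / C) ltac:(lra) (divr_gt0 delta0 C0).
pose D := C `^ s * (B + 1).
have D0 : 0 < D by rewrite mulr_gt0 ?powR_gt0//; lra.
have q1 : 0 <= eta `^ e < 1.
  have pe : 1 `^ e = 1 :> R by rewrite powR1.
  rewrite powR_ge0/= -[ltRHS]pe; apply: gt0_ltr_powR => //; rewrite nnegrE ?ler01//.
  exact: ltW.
have [N2 N2P] := small_expr q1 (divr_gt0 eps0 D0).
pose n := (maxn N1 N2).+1.
apply: (limit_set_cover_le (n := n) s0).
  by rewrite mulrC -ler_pdivlMr// N1P// leqW// leq_maxl.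
move=> F uF sF.
have -> : eps = (eps / D) * D by rewrite divfK// gt_eqF.
apply: le_trans (_ : (eta `^ e) ^+ n * D <= _); last first.
  by rewrite ler_pM2r// N2P// leqW// leq_maxr.
apply: le_trans (_ : \sum_(w <- F) C `^ s * (eta `^ e) ^+ n * a w `^ t <= _).
  rewrite big_seq [leRHS]big_seq; apply: ler_sum => w /sF sw.
  have aw := coded_pos cs w.
  rewrite powRM ?(ltW aw) ?(ltW C0)// -mulrA ler_pM2l ?powR_gt0//.
  rewrite /s powRD; last by rewrite gt_eqF ?implybT// gt_eqF.
  rewrite mulrC ler_pM2r ?powR_gt0//.
  rewrite -powR_mulrn ?powR_ge0// -powRrM mulrC powRrM powR_mulrn ?(ltW eta0)//.
  apply: ge0_ler_powR; rewrite ?nnegrE ?(ltW e0) ?(ltW aw) ?exprn_ge0 ?(ltW eta0)//.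
  by rewrite -sw (coded_contract cs).
rewrite -mulr_sumr [C `^ s * _]mulrC -mulrA.
apply: ler_wpM2l; first by rewrite exprn_ge0// powR_ge0.
apply: ler_wpM2l; first exact: powR_ge0.
by have := FB n F isT uF sF; lra.
Qed.

End HausdorffDimension.

(** * Packing *)

(* Distinct points fall into distinct cells of a grid of mesh alpha / (d + 1). *)
Lemma separated_family_bounded (R : realType) (d : nat) (q : R) :
  exists N : nat, forall (I : eqType) (s : seq I) (f : I -> 'rV[R]_d) (alpha : R),
    0 < alpha -> uniq s ->
    (forall i j, i \in s -> j \in s -> i != j -> alpha <= enorm (f i - f j)) ->
    (forall i j, i \in s -> j \in s -> enorm (f i - f j) <= q * alpha) ->
    (size s <= N)%N.
Proof.
pose Q := `|q| * d.+1%:R; pose M := Num.truncn (2 * Q).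
exists #|{: {ffun 'I_d -> 'I_M.+1}}| => I s f alpha alpha0 us sep sq.
case: s => // i0 s in us sep sq *.
have i0s : i0 \in i0 :: s by rewrite mem_head.
pose h := alpha / d.+1%:R; have h0 : 0 < h by rewrite divr_gt0.
(* Coordinates in units of the mesh, shifted by [Q] so that truncation acts on numbers in
   [0, 2Q]. *)
pose v i k := (f i - f i0) ord0 k / h + Q.
have v02 i k : i \in i0 :: s -> 0 <= v i k <= 2 * Q.
  move=> iS; have : `|(f i - f i0) ord0 k / h| <= Q.
    rewrite normrM normfV (gtr0_norm h0) ler_pdivrMr// /Q /h -mulrA.
    rewrite [X in _ * X]mulrCA divff// mulr1.
    apply: le_trans (enorm_coord _ _) _; apply: le_trans (sq _ _ iS i0s) _.
    by rewrite ler_pM2r// ler_norm.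
  by rewrite ler_norml /v; lra.
pose cell i := [ffun k => inord (Num.truncn (v i k)) : 'I_M.+1].
have cell_inj : {in i0 :: s &, injective cell}.
  move=> i j iS jS /ffunP cij; apply/eqP/negPn/negP => ij.
  have := sep i j iS jS ij; rewrite leNgt => /negP; apply.
  apply: le_lt_trans (enorm_le_norm _) _.
  apply: (@le_lt_trans _ _ (d%:R * h)); last first.
    rewrite /h mulrA ltr_pdivrMr ?ltr0n// mulrC ltr_pM2l// ltr_nat//.
  rewrite ler_wpM2l// [leLHS]/Num.norm/= mx_normrE.
  apply/bigmax_leP; split; first exact: ltW.
  move=> [u k] _ /=; rewrite (ord1 u).
  have vM l : l \in i0 :: s -> (Num.truncn (v l k) < M.+1)%N.
    by move=> lS; have /andP[_ v2] := v02 l k lS; rewrite ltnS le_truncn.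
  have := congr1 (@nat_of_ord _) (cij k); rewrite !ffunE !inordK ?vM// => tij.
  have /andP[vi0 _] := v02 i k iS; have /andP[vj0 _] := v02 j k jS.
  have /andP[ti1 ti2] := truncn_itv vi0.
  have := truncn_itv vj0; rewrite -tij => /andP[tj1 tj2].
  have : `|v i k - v j k| <= 1.
    by rewrite ler_norml; move: ti1 ti2 tj1 tj2; rewrite -natr1; lra.
  have -> : v i k - v j k = (f i - f j) ord0 k / h by rewrite /v !mxE; field; lra.
  by rewrite normrM normfV (gtr0_norm h0) ler_pdivrMr// mul1r.
rewrite -(size_map cell) -(card_uniqP _) ?max_card//.
by rewrite map_inj_in_uniq.
Qed.

(** * Integration over a tree of words *)

Section TreeIntegral.
Variables (R : realType) (E : nat -> seq (seq nat)) (p : nat -> seq nat -> R).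
Implicit Types (g h : seq nat -> R) (v w e : seq nat).

Fixpoint level j n : seq (seq nat) :=
  if n is n'.+1 then [seq e ++ w | e <- E j, w <- level j.+1 n'] else [:: [::]].

(** The expectation of [g] over continuations of [v] by [n] independent random blocks, from stage
    [j] on. Such finite expectations replace a measure on infinite words. *)
Fixpoint integ j n g v : R :=
  if n is n'.+1 then \sum_(e <- E j) p j e * integ j.+1 n' g (v ++ e) else g v.

Hypothesis p_ge0 : forall j e, 0 <= p j e.
Hypothesis p_sum : forall j, \sum_(e <- E j) p j e = 1.

Lemma mem_level0 j w : (w \in level j 0) = (w == [::]).
Proof. by rewrite inE. Qed.

Lemma level_catP j n w : reflect
  (exists2 e, e \in E j & exists2 w', w' \in level j.+1 n & w = e ++ w')
  (w \in level j n.+1).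
Proof.
apply: (iffP allpairsP) => [[[e w'] /= [eE wl ->]]|[e eE [w' wl ->]]].
  by exists e => //; exists w'.
by exists (e, w').
Qed.

Lemma integ_le j n g h v : (forall w, w \in level j n -> g (v ++ w) <= h (v ++ w)) ->
  integ j n g v <= integ j n h v.
Proof.
elim: n j v => [|n IH] j v gh /=; first by have := gh [::]; rewrite cats0 mem_head; exact.
rewrite big_seq [leRHS]big_seq; apply: ler_sum => e eE.
rewrite ler_wpM2l//; apply: IH => w wl; rewrite -catA; apply: gh.
by apply/level_catP; exists e => //; exists w.
Qed.

Lemma integ_cst j n (x : R) v : integ j n (fun=> x) v = x.
Proof.
elim: n j v => //= n IH j v; rewrite -[RHS]mul1r -(p_sum j) mulr_suml.
by apply: eq_bigr => e _; rewrite IH.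
Qed.

Lemma integ_sum j n (m : nat) (G : nat -> seq nat -> R) v :
  integ j n (fun w => \sum_(i < m) G i w) v = \sum_(i < m) integ j n (G i) v.
Proof.
elim: n j v => //= n IH j v; rewrite exchange_big/=; apply: eq_bigr => e _.
by rewrite IH mulr_sumr.
Qed.

Lemma integ_ge0 j n g v : (forall w, 0 <= g w) -> 0 <= integ j n g v.
Proof. by move=> g0; rewrite -(integ_cst j n 0 v); apply: integ_le. Qed.

Section Bounds.
Variables (a : seq nat -> R) (K : R).
Hypotheses (a_gt0 : forall w, 0 < a w) (K_gt0 : 0 < K).
Hypothesis a_geM : forall u v, a u * a v <= K * a (u ++ v).

(* Every branch is stopped at the last level i where its word w still has
   a w > r; one more step divides a w by at most q i. *)
Lemma integ_first_passage (q : nat -> R) (r : R) (P : pred (seq nat)) j n v :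
  (forall i e, e \in E i -> K <= q i * a e) -> 0 < r ->
  (forall w w', P (w ++ w') -> P w) ->
  (forall w, w \in level j n -> a (v ++ w) <= r) -> r < a v ->
  integ j n (fun w => (P w)%:R) v <=
  \sum_(i < n) integ j i (fun w => ([&& r < a w, a w <= q (j + i)%N * r & P w])%:R) v.
Proof.
move=> qK r0 Pcat; elim: n j v => [|n IH] j v al av.
  by have := al [::]; rewrite mem_head cats0 => /(_ isT); rewrite leNgt av.
have I0 i : 0 <= integ j i (fun w => ([&& r < a w, a w <= q (j + i)%N * r & P w])%:R) v.
  by apply: integ_ge0 => w; case: (X in X%:R).
have [Pv|nPv] := boolP (P v); last first.
  apply: le_trans (_ : 0 <= _); last by apply: sumr_ge0.
  rewrite -(integ_cst j n.+1 0 v); apply: integ_le => w _.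
  by case: (boolP (P (v ++ w))) => // /Pcat; rewrite (negbTE nPv).
(* In the first case the term [i = 0] equals 1 and suffices. In the second, every child still has
   [a] above [r], and the induction applies to each child. *)
have [avq|avq] := leP (a v) (q j * r).
  rewrite big_ord_recl/= addn0 av avq Pv.
  apply: le_trans (_ : 1 <= _); last first.
    by rewrite lerDl; apply: sumr_ge0 => i _; exact: I0 (lift ord0 i).
  rewrite -[leRHS](integ_cst j n.+1 1 v); apply: (integ_le (n := n.+1)) => w _.
  by case: (P _).
rewrite big_ord_recl; apply: ler_wpDl; first exact: I0.
apply: (@le_trans _ _ (\sum_(e <- E j) p j e * \sum_(i < n) integ j.+1 i
    (fun w => ([&& r < a w, a w <= q (j.+1 + i)%N * r & P w])%:R) (v ++ e))).
  rewrite /= big_seq [leRHS]big_seq; apply: ler_sum => e eE; rewrite ler_wpM2l//.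
  apply: IH => [w wl|].
    by rewrite -catA; apply: al; apply/level_catP; exists e => //; exists w.
  rewrite -(ltr_pM2l K_gt0); apply: lt_le_trans (a_geM v e).
  apply: le_lt_trans (_ : q j * r * a e < _); last by rewrite ltr_pM2r.
  by rewrite mulrAC ler_pM2r// qK.
under eq_bigr do rewrite mulr_sumr.
rewrite exchange_big/=; apply: ler_sum => i _.
by under [leRHS]eq_bigr do rewrite /bump/= addnA addn1.
Qed.

(** Iterating the one-block inequality turns the probability of [w] times a(v)^t into the product of
    the [gam] times a(v ++ w)^t, at most [A] where [P] holds; only a count of words remains. *)
Lemma integ_count (t A : R) (gam : nat -> R) (P : pred (seq nat)) j n v :
  0 <= A -> (forall i, 0 <= gam i) ->
  (forall i e w, e \in E i -> p i e * a w `^ t <= gam i * a (w ++ e) `^ t) ->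
  (forall w, P w -> a w `^ t <= A) ->
  integ j n (fun w => (P w)%:R) v * a v `^ t <=
  (\prod_(i < n) gam (j + i)%N) * A * \sum_(w <- level j n) (P (v ++ w))%:R.
Proof.
move=> A0 gam0 pgam PA; elim: n j v => [|n IH] j v.
  rewrite big_ord0 mul1r /= big_seq1 cats0.
  by case: (boolP (P v)) => [/PA|]; rewrite ?mul1r ?mulr1// mul0r mulr0.
rewrite big_ord_recl/= addn0 big_allpairs_dep/= mulr_suml mulr_sumr.
rewrite big_seq [leRHS]big_seq; apply: ler_sum => e eE.
have I0 : 0 <= integ j.+1 n (fun w => (P w)%:R) (v ++ e).
  by apply: integ_ge0 => w; case: (P w).
apply: (@le_trans _ _ (gam j * (integ j.+1 n (fun w => (P w)%:R) (v ++ e) * a (v ++ e) `^ t))).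
  by rewrite mulrAC [leRHS]mulrCA [leRHS]mulrC ler_wpM2r// pgam.
rewrite -!mulrA ler_wpM2l//; apply: le_trans (IH _ _) _.
rewrite -mulrA le_eqVlt; apply/orP; left; apply/eqP; congr (_ * (_ * _)).
  by apply: eq_bigr => i _; rewrite /bump/= addnA addn1.
by apply: eq_bigr => w _; rewrite catA.
Qed.
End Bounds.

Lemma level_size j n m : (forall i e, e \in E i -> size e = m i) ->
  forall w, w \in level j n -> size w = \sum_(i < n) m (j + i)%N.
Proof.
move=> Em; elim: n j => [|n IH] j w; first by rewrite mem_level0 => /eqP->; rewrite big_ord0.
move=> /level_catP[e /Em eE [w' /IH w'l ->]].
rewrite size_cat eE w'l big_ord_recl addn0; congr addn.
by apply: eq_bigr => i _; rewrite /bump/= addnA addn1.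
Qed.

(** Blocks of one stage have a common length, so a concatenation determines its blocks. *)
Lemma level_uniq j n m : (forall i e, e \in E i -> size e = m i) ->
  (forall i, uniq (E i)) -> uniq (level j n).
Proof.
move=> Em Eu; elim: n j => [|n IH] j //=.
apply: allpairs_uniq => // -[e w] [e' w'] /allpairsP[[? ?] /= [eE _ [-> ->]]].
move=> /allpairsP[[? ?] /= [eE' _ [-> ->]]] /eqP.
by rewrite eqseq_cat ?(Em _ _ eE) ?(Em _ _ eE')// => /andP[/eqP-> /eqP->].
Qed.

Lemma size_level : (forall j e, e \in E j -> e <> [::]) ->
  forall n j w, w \in level j n -> (n <= size w)%N.
Proof.
move=> E0; elim=> [//|n IH] j w /level_catP[e /E0 e0 [w' /IH nw ->]].
by rewrite size_cat; case: e e0 => // x s _; rewrite addSn ltnS (leq_trans nw)// leq_addl.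
Qed.

End TreeIntegral.

(** * The mass of a small set *)

(* An insertion of u k is made only once the accumulated product, doubled at
   each level, is so small that this insertion keeps it below 1. *)
Lemma sparse_insertion (R : realType) (T : Type) (gam kap : T -> R) (u : nat -> T) (F : T) :
  (forall e, 0 <= gam e) -> (forall e, 0 <= kap e) -> gam F <= 4^-1 ->
  exists E : nat -> T, [/\ forall j, E j = F \/ exists k, E j = u k,
    forall k, exists j, E j = u k &
    forall j, (\prod_(i < j) gam (E i)) * kap (E j) <= (1 + kap F) * 2^-1 ^+ j].
Proof.
move=> gam0 kap0 gF.
(* The state holds 2^j times the product so far and the index of the next insertion. The [kap] part
   gives the bound at the present level; the [2 * gam] part keeps the first component at most 1
   afterwards. *)
pose fits (s : R * nat) := s.1 * (kap (u s.2) + 2 * gam (u s.2)) <= 1.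
pose alph (s : R * nat) := if fits s then u s.2 else F.
pose step (s : R * nat) := (2 * gam (alph s) * s.1, if fits s then s.2.+1 else s.2).
pose st j := iter j step (1, 0%N).
have Sb j : 0 <= (st j).1 <= 1.
  elim: j => [|j /andP[b0 b1]]; first by rewrite /= ler01 lexx.
  rewrite [st _]/= -/(st j) /step /alph /=; case: ifP => [|_].
    rewrite /fits => fit; rewrite mulr_ge0 ?mulr_ge0//=.
    by apply: le_trans fit; rewrite mulrDr [leLHS]mulrC lerDr mulr_ge0.
  rewrite mulr_ge0 ?mulr_ge0//=; have := gam0 F; nra.
have Sprod j : (\prod_(i < j) gam (alph (st i))) = (st j).1 * 2^-1 ^+ j.
  elim: j => [|j IH]; first by rewrite big_ord0 /= mulr1.
  rewrite big_ord_recr/= IH -/(st j) exprS; by field.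
exists (fun j => alph (st j)); split.
- by move=> j; rewrite /alph; case: ifP => _; [right; exists (st j).2|left].
(* While an insertion waits, each [F]-step at least halves the first component, because [gam F] is
   at most 1/4; so the insertion eventually fits. *)
- have reach k : exists2 j, (st j).2 = k & fits (st j).
    suff wait j : exists2 i, (st i).2 = (st j).2 & fits (st i).
      elim: k => [|k [j <- fj]]; first exact: (wait 0%N).
      by have [i ij fi] := wait j.+1; exists i => //; rewrite ij /= -/(st j) /step fj.
    apply: contrapT => nofit.
    have {}nofit i : (st i).2 = (st j).2 -> ~~ fits (st i).
      by move=> ij; apply/negP => fi; apply: nofit; exists i.
    have decay n : (st (n + j)).2 = (st j).2 /\ (st (n + j)).1 <= 2^-1 ^+ n.
      elim: n => [|n [nk nb]]; first by split=> //; case/andP: (Sb j).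
      have /negbTE nf := nofit _ nk.
      have -> : st (n.+1 + j)%N = step (st (n + j)%N) by [].
      rewrite /step /alph nf /=; split=> //.
      rewrite exprS; have := gam0 F; have /andP[b0 _] := Sb (n + j)%N.
      by move: nb; move: (2^-1 ^+ n) => z nb g0; nra.
    pose L := kap (u (st j).2) + 2 * gam (u (st j).2).
    have L0 : 0 <= L by rewrite addr_ge0// mulr_ge0.
    have [||n nP] := small_expr (q := 2^-1 : R) (e := (1 + L)^-1); first lra.
      by rewrite invr_gt0; lra.
    have [nk nb] := decay n; have := nofit _ nk; rewrite /fits nk -/L => /negP; apply.
    have /andP[b0 _] := Sb (n + j)%N.
    apply: le_trans (_ : (1 + L)^-1 * L <= _); last by rewrite ler_pdivrMl; lra.
    by apply: ler_wpM2r => //; apply: le_trans nb (nP _ (leqnn _)).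
  by move=> k; have [j jk fj] := reach k; exists j; rewrite /alph fj jk.
- move=> j; rewrite Sprod mulrAC ler_wpM2r ?exprn_ge0 ?invr_ge0//.
  have /andP[b0 b1] := Sb j; rewrite /alph; case: ifP => [|_].
    rewrite /fits => fit; apply: le_trans (_ : 1 <= _); last by rewrite lerDl.
    by apply: le_trans fit; rewrite mulrDr lerDl !mulr_ge0.
  by have := kap0 F; nra.
Qed.

Section MassBound.
Variables (R : realType) (d : nat).
Variables (X : set 'rV[R]_d) (phi : nat -> 'rV[R]_d -> 'rV[R]_d) (x0 : 'rV[R]_d).
Variables (a : seq nat -> R) (K eta C c : R).
Hypothesis (cs : coded_system X phi x0 a K eta C c).

Definition meets (U : set 'rV[R]_d) (w : seq nat) : bool :=
  `[< (word_comp phi w @` X) `&` U !=set0 >].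

Lemma meets_cat U w w' : meets U (w ++ w') -> meets U w.
Proof.
move=> /asboolP[y [[x Xx xy] Uy]]; apply/asboolP; exists y; split=> //.
exists (word_comp phi w' x); first exact: (coded_stable cs).
by rewrite -xy; apply: esym; exact: word_comp_cat.
Qed.

(** The points phi_w(x0) are [c * r] apart by [coded_sep], and within (2Cq + D) r of each other
    since their pieces meet [U]; the packing bound depends only on the ratio. *)
Lemma meets_count (q D : R) : exists N : nat,
  forall n r (U : set 'rV[R]_d) (s : seq (seq nat)),
  0 < r -> diam_le U (D * r) -> uniq s ->
  (forall w, w \in s -> [/\ size w = n, r <= a w, a w <= q * r & meets U w]) ->
  (size s <= N)%N.
Proof.
have [C0 c0] := (coded_C0 cs, coded_c0 cs).
have [N NP] := separated_family_bounded d ((2 * C * q + D) / c).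
exists N => n r U s r0 Ud us sP.
apply: (NP _ s (fun w => word_comp phi w x0) (c * r)) => //; first exact: mulr_gt0.
- move=> w w' ws w's ww'; have [sw rw _ _] := sP w ws; have [sw' _ _ _] := sP w' w's.
  apply: le_trans (coded_sep cs _ _); last exact/eqP.
    by rewrite ler_pM2l.
  by rewrite sw sw'.
- move=> w w' ws w's; have [_ _ wq] := sP w ws; have [_ _ wq'] := sP w' w's.
  move=> /asboolP[y' [[x' Xx' xy'] Uy']] /asboolP[y [[x Xx xy] Uy]].
  have H : enorm (word_comp phi w x0 - y) <= C * (q * r).
    rewrite -xy; apply: le_trans (coded_diam cs _ (coded_base cs) Xx) _.
    by rewrite ler_pM2l.
  have H' : enorm (y' - word_comp phi w' x0) <= C * (q * r).
    rewrite -xy'; apply: le_trans (coded_diam cs _ Xx' (coded_base cs)) _.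
    by rewrite ler_pM2l.
  have Hy := Ud _ _ Uy Uy'.
  have -> : (2 * C * q + D) / c * (c * r) = C * (q * r) + (D * r) + C * (q * r).
    by field; rewrite gt_eqF.
  apply: le_trans (ler_enorm_dist _ y' _) _; apply: lerD => //.
  by apply: le_trans (ler_enorm_dist _ y _) _; apply: lerD.
Qed.

(** First passage splits the mass by stopping level. At level [i], [integ_count] and [meets_count]
    bound it by a product of [gam] times [kap] times r^t, and [sparse_insertion] makes these terms
    geometrically small. *)
Lemma mass_bound (t : R) (n : nat) (F : seq (seq nat)) (u : nat -> seq nat) :
  0 < t -> (0 < n)%N -> uniq F -> (forall w, w \in F -> size w = n) ->
  4 * K `^ t <= \sum_(w <- F) a w `^ t -> (forall k, u k <> [::]) ->
  exists (E : nat -> seq (seq nat)) (p : nat -> seq nat -> R) (M : R),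
  [/\ forall j e, e \in E j -> e <> [::],
      forall k, exists j, E j = [:: u k],
      (forall j e, 0 <= p j e) /\ (forall j, \sum_(e <- E j) p j e = 1),
      0 < M &
      forall U r N, 0 < r -> diam_le U (3 * r) ->
        (forall w, w \in level E 0 N -> a w <= r) ->
        integ E p 0 N (fun w => (meets U w)%:R) [::] <= M * r `^ t].
Proof.
move=> t0 n0 uF sF FZ u0.
have K0 : 0 < K := lt_le_trans ltr01 (coded_K cs).
have Kt : 0 < K `^ t by exact: powR_gt0.
have apos := coded_pos cs.
pose Z (E : seq (seq nat)) := \sum_(e <- E) a e `^ t.
(* The sum dominates each K / a(e), as [integ_first_passage] requires of a single step. *)
pose q (E : seq (seq nat)) := \sum_(e <- E) K / a e.
have q0 E : 0 <= q E by apply: sumr_ge0 => e _; rewrite divr_ge0 ?ltW.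
have Z0 E : 0 <= Z E by apply: sumr_ge0 => e _; rewrite powR_ge0.
pose cnt (x : R) : nat := projT1 (cid (meets_count x 3)).
pose gam (E : seq (seq nat)) := K `^ t / Z E.
(* The cost of the jump in scale: stopped words satisfy a(w) <= q r, and at most [cnt (q E)] of them
   meet a set of diameter 3r. *)
pose kap (E : seq (seq nat)) := q E `^ t * (cnt (q E))%:R.
have gam0 E : 0 <= gam E by rewrite divr_ge0 ?powR_ge0.
have kap0 E : 0 <= kap E by rewrite mulr_ge0 ?powR_ge0.
have ZF : 0 < Z F by apply: lt_le_trans FZ; lra.
have gF : gam F <= 4^-1.
  by rewrite /gam ler_pdivrMr// ler_pdivlMl.
(* An inserted word is a stage with a single block, taken with probability 1. *)
have [E [EF Eu EP]] := sparse_insertion (fun k => [:: u k]) gam0 kap0 gF.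
pose m j := size (head [::] (E j)).
have F0 : F != [::] by apply/eqP => F0; move: ZF; rewrite /Z F0 big_nil ltxx.
have Em j e : e \in E j -> size e = m j.
  rewrite /m; have [->|[k ->]] := EF j.
    move=> eF; rewrite (sF e)// sF//.
    by move: F0 {eF}; case: (F) => // x s _; rewrite mem_head.
  by rewrite inE => /eqP ->.
have E0 j e : e \in E j -> e <> [::].
  have [->|[k ->]] := EF j; last by rewrite inE => /eqP ->.
  by move=> /sF se e0; move: n0; rewrite -se e0.
have EZ j : 0 < Z (E j).
  by have [->//|[k ->]] := EF j; rewrite /Z big_seq1 powR_gt0.
have Euniq j : uniq (E j) by have [->//|[k ->]] := EF j.
pose p j e := a e `^ t / Z (E j).
have p0 j e : 0 <= p j e by rewrite divr_ge0 ?powR_ge0.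
have p1 j : \sum_(e <- E j) p j e = 1 by rewrite -mulr_suml -/(Z _) divff ?gt_eqF ?EZ.
pose M0 := 1 + kap F; have M00 : 0 < M0 by have := kap0 F; rewrite /M0; lra.
exists E, p, (2 * M0 + 1); split=> //; first by rewrite addr_gt0 ?mulr_gt0.
move=> U r N r0 Ud aN.
(* For [r >= 1] the total mass 1 is small enough; otherwise [r] is below a([::]) = 1, where first
   passage can start. *)
have [r1|r1] := leP 1 r.
  apply: le_trans (_ : 1 <= _).
    rewrite -[leRHS](integ_cst p1 0 N 1 [::]); apply: integ_le => // w _.
    by case: meets.
  apply: le_trans (_ : 1 * 1 <= _); first by rewrite mulr1.
  apply: ler_pM => //; first lra.
  have <- : 1 `^ t = 1 :> R by rewrite powR1.
  by apply: ge0_ler_powR; rewrite ?nnegrE ?(ltW t0) ?(ltW r0).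
apply: le_trans (integ_first_passage p0 p1 apos K0 (coded_geM cs) (q := fun j => q (E j)) _ r0
  (@meets_cat U) _ _) _ => //.
- move=> i e eE; rewrite /q (big_rem e)//= mulrDl divfK ?gt_eqF ?apos// lerDl.
  apply: mulr_ge0 (ltW (apos e)); apply: sumr_ge0 => x _.
  exact: divr_ge0 (ltW K0) (ltW (apos x)).
- by rewrite (coded_nil cs).
apply: le_trans (_ : \sum_(i < N) M0 * r `^ t * 2^-1 ^+ i <= _).
  apply: ler_sum => i _; rewrite add0n.
  pose Q w := [&& r < a w, a w <= q (E i) * r & meets U w].
  have QA w : Q w -> a w `^ t <= (q (E i) * r) `^ t.
    move=> /and3P[_ aq _]; apply: ge0_ler_powR; rewrite ?nnegrE ?(ltW t0) ?(ltW (apos w))//.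
    by rewrite mulr_ge0// ltW.
  have pg k e w : e \in E k -> p k e * a w `^ t <= gam (E k) * a (w ++ e) `^ t.
    move=> _; rewrite /p /gam mulrAC [leRHS]mulrAC ler_wpM2r ?invr_ge0//.
    rewrite -!powRM ?(ltW (apos _)) ?(ltW K0)//.
    apply: ge0_ler_powR; rewrite ?nnegrE ?mulr_ge0 ?(ltW t0) ?(ltW (apos _)) ?(ltW K0)//.
    by rewrite mulrC (coded_geM cs).
  have := integ_count (gam := fun j => gam (E j)) p0 p1 0 i [::] (powR_ge0 _ _)
    (fun i => gam0 (E i)) pg QA.
  have pe : 1 `^ t = 1 :> R by rewrite powR1.
  rewrite (coded_nil cs) pe mulr1 => /le_trans; apply.
  have Qcnt : \sum_(w <- level E 0 i) (Q ([::] ++ w))%:R <= (cnt (q (E i)))%:R :> R.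
    rewrite -natr_sum ler_nat -big_mkcond/= sum1_count -size_filter.
    apply: (projT2 (cid (meets_count (q (E i)) 3)) (\sum_(k < i) m (0 + k)%N) r U) => //.
      by rewrite filter_uniq// (level_uniq _ _ Em).
    move=> w; rewrite mem_filter => /andP[/and3P[ra aq mw] wl]; split=> //.
      exact: (level_size Em wl).
    exact: ltW.
  have PG0 : 0 <= \prod_(k < i) gam (E (0 + k)%N) by apply: prodr_ge0 => k _.
  apply: le_trans (ler_wpM2l (mulr_ge0 PG0 (powR_ge0 _ _)) Qcnt) _.
  rewrite powRM ?(ltW r0)//.
  have := EP i; rewrite /kap -/M0 => H.
  have := ler_wpM2r (powR_ge0 r t) H.
  rewrite mulrAC [X in _ -> _ <= X]mulrAC; apply: le_trans.
  by rewrite le_eqVlt; apply/orP; left; apply/eqP; ring.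
rewrite -mulr_sumr.
have geo k : \sum_(i < k) (2^-1 : R) ^+ i = 2 - 2 * 2^-1 ^+ k.
  elim: k => [|k IH]; first by rewrite big_ord0 expr0; ring.
  by rewrite big_ord_recr/= IH exprS; field.
have h0 : 0 <= (2^-1 : R) ^+ N by rewrite exprn_ge0// invr_ge0.
rewrite geo; have := powR_ge0 r t; move: (r `^ t) => T T0.
have : 0 <= M0 * T * 2^-1 ^+ N by rewrite !mulr_ge0// ltW.
by move: (2^-1 ^+ N) => z; nra.
Qed.

End MassBound.

(** * Sequences with dense orbit *)

Section InfiniteWord.
Variable e : nat -> seq nat.
Hypothesis e_neq0 : forall j, e j <> [::].

Fixpoint concat j : seq nat := if j is j'.+1 then concat j' ++ e j' else [::].

(** As blocks are nonempty, [concat i.+1] has more than [i] letters, and the default 0 is never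
    read. *)
Definition infinite_word : {ptws nat -> nat} := fun i => nth 0%N (concat i.+1) i.

Lemma size_concat j : (j <= size (concat j))%N.
Proof.
elim: j => //= j IH; rewrite size_cat.
by have := @e_neq0 j; case: (e j) => // x s _; rewrite /= addnS ltnS (leq_trans IH)// leq_addr.
Qed.

Lemma nth_concat j k i : (j <= k)%N -> (i < size (concat j))%N ->
  nth 0%N (concat k) i = nth 0%N (concat j) i.
Proof.
move=> /subnKC <-; elim: (k - j)%N => [|l IH] ij; first by rewrite addn0.
rewrite addnS /= nth_cat ifT ?IH//; apply: leq_trans ij _.
elim: l {IH} => [|l IH]; first by rewrite addn0.
by rewrite addnS /= size_cat (leq_trans IH)// leq_addr.
Qed.

Lemma infinite_wordE j i : (i < size (concat j))%N ->
  infinite_word i = nth 0%N (concat j) i.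
Proof.
move=> ij; have [ji|ji] := leqP j i.+1; first by rewrite /infinite_word (nth_concat ji).
by rewrite /infinite_word (nth_concat (ltnW ji))// (size_concat i.+1).
Qed.

Lemma take_concat j n : (n <= size (concat j))%N ->
  [seq infinite_word i | i <- iota 0 n] = take n (concat j).
Proof.
move=> nj; apply: (@eq_from_nth _ 0%N).
  by rewrite size_map size_iota size_takel.
move=> i; rewrite size_map size_iota => ni.
rewrite (nth_map 0%N) ?size_iota// nth_iota// add0n nth_take//.
by apply: infinite_wordE; exact: leq_trans nj.
Qed.

Lemma iter_shift n (om : {ptws nat -> nat}) i : iter n Defs.shift om i = om (n + i)%N.
Proof.
elim: n i => [|n IH] i //=.
by rewrite /Defs.shift IH addnS addSn.
Qed.

(** Each prefix of a given sequence begins some block; shifting to the starts of such blocks gives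
    pointwise convergence to that sequence. *)
Lemma infinite_word_dense :
  (forall w : seq nat, exists j, exists w', e j = w ++ w') -> I_dense infinite_word.
Proof.
move=> ew O [f Of] Oo.
have occ m : exists n, forall i, (i < m)%N -> iter n Defs.shift infinite_word i = f i.
  have [j [w' ej]] := ew (mkseq f m); exists (size (concat j)) => i im.
  rewrite iter_shift (@infinite_wordE j.+1) /= ?size_cat ?ltn_add2l; last first.
    by rewrite ej size_cat size_mkseq (leq_trans im)// leq_addr.
  rewrite nth_cat ltnNge leq_addr/= addKn ej nth_cat size_mkseq im.
  by rewrite nth_mkseq.
have [nn nnP] := choice occ.
have : (fun m => iter (nn m) Defs.shift infinite_word) @ \oo --> (f : {ptws nat -> nat}).
  apply/pointwise_cvgP => i A fA; exists i.+1 => // m /= im.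
  by rewrite /= nnP//; exact: nbhs_singleton.
have Of' : nbhs (f : {ptws nat -> nat}) O by apply: open_nbhs_nbhs.
move=> /(_ O Of') [N _ NO].
by exists (iter (nn N) Defs.shift infinite_word); split; [exact: NO (leqnn _)|exists (nn N)].
Qed.
End InfiniteWord.

(** The pieces of the successive concatenations are closed and decreasing in the compact [X]; a
    cluster point of the images of [x0] lies in all of them. *)
Lemma dense_code_point (R : realType) (d : nat) (X : set 'rV[R]_d)
    (phi : nat -> 'rV[R]_d -> 'rV[R]_d) x0 a K eta C c (e : nat -> seq nat) :
  coded_system X phi x0 a K eta C c -> (forall j, e j <> [::]) ->
  (forall w : seq nat, exists j, exists w', e j = w ++ w') ->
  exists2 x, J_dense X phi x & forall j, (word_comp phi (concat e j) @` X) x.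
Proof.
move=> cs e0 ew.
have mono u v : word_comp phi (u ++ v) @` X `<=` word_comp phi u @` X.
  move=> _ [x Xx <-]; exists (word_comp phi v x); first exact: (coded_stable cs).
  by apply: esym; exact: word_comp_cat.
have chain j k : (j <= k)%N ->
    word_comp phi (concat e k) @` X `<=` word_comp phi (concat e j) @` X.
  move=> /subnKC <-; elim: (k - j)%N => [|l IH]; first by rewrite addn0.
  by rewrite addnS /=; apply: subset_trans IH; exact: mono.
pose y n := word_comp phi (concat e n) x0.
have [x [Xx clx]] : X `&` cluster (y @ \oo) !=set0.
  apply: (coded_compact cs); exists 0%N => // n _ /=.
  exact: (coded_stable cs) (coded_base cs).
have xj j : (word_comp phi (concat e j) @` X) x.
  have : closure (word_comp phi (concat e j) @` X) x.
    move=> B xB.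
    apply: clx xB; exists j => // n /= jn; apply: chain jn _ _.
    by exists x0 => //; exact: (coded_base cs).
  exact: (coded_closed cs).
exists x => //; exists (infinite_word e); first exact: infinite_word_dense.
move=> n; rewrite (take_concat e0 (size_concat e0 n)).
have := xj n; rewrite -{1}(cat_take_drop n (concat e n)); exact: mono.
Qed.

(** * Lower bound *)

(* Koenig's lemma: a path all of whose nodes fail the conclusion would avoid
   every Cov i. *)
Lemma finite_bar (E : nat -> seq (seq nat)) (Cov : nat -> seq nat -> Prop) :
  (forall i w w', Cov i w -> Cov i (w ++ w')) ->
  (forall e, (forall j, e j \in E j) -> exists j i, Cov i (concat e j)) ->
  exists N0 m, forall N, (N0 <= N)%N -> forall w, w \in level E 0 N ->
    exists2 i, (i < m)%N & Cov i w.
Proof.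
move=> Ccat bar.
pose good j v := exists N0 m, forall N, (N0 <= N)%N -> forall w, w \in level E j N ->
  exists2 i, (i < m)%N & Cov i (v ++ w).
suff : good 0%N [::] by [].
have step j v : (forall e, e \in E j -> good j.+1 (v ++ e)) -> good j v.
  move=> goodE; suff [N0 [m mP]] : exists N0 m, forall e, e \in E j ->
      forall N, (N0 <= N)%N -> forall w, w \in level E j.+1 N ->
      exists2 i, (i < m)%N & Cov i ((v ++ e) ++ w).
    exists N0.+1, m => -[//|N] /= N0N _ /level_catP[e eE [w wl ->]].
    by rewrite catA; exact: mP wl.
  elim: (E j) goodE => [|e s IH] goodE; first by exists 0%N, 0%N.
  have [N1 [m1 P1]] : exists N0 m, forall e, e \in s ->
      forall N, (N0 <= N)%N -> forall w, w \in level E j.+1 N ->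
      exists2 i, (i < m)%N & Cov i ((v ++ e) ++ w).
    by apply: IH => e' e's; apply: goodE; rewrite inE e's orbT.
  have [N2 [m2 P2]] := goodE e (mem_head _ _).
  exists (maxn N1 N2), (maxn m1 m2) => e' + N; rewrite geq_max inE.
  move=> /predU1P[->|e's] /andP[NN1 NN2] w wl.
    by have [i im Ci] := P2 N NN2 w wl; exists i => //; rewrite leq_max im orbT.
  by have [i im Ci] := P1 e' e's N NN1 w wl; exists i => //; rewrite leq_max im.
have next (s : nat * seq nat) : exists e, ~ good s.1 s.2 ->
    e \in E s.1 /\ ~ good s.1.+1 (s.2 ++ e).
  have [gs|ngs] := pselect (good s.1 s.2); first by exists [::].
  apply: contrapT => none; apply: ngs; apply: step => e eE.
  by apply: contrapT => nge; apply: none; exists e.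
have [nx nxP] := choice next; apply: contrapT => bad.
pose st j := iter j (fun s => (s.1.+1, s.2 ++ nx s)) (0%N, [::]).
pose e j := nx (st j).
have stE j : st j = (j, concat e j) by elim: j => //= j IH; rewrite -/(st j) IH /= /e IH.
have badst j : ~ good j (concat e j).
  elim: j => [//|j IH]; have := nxP (st j); rewrite stE => /(_ IH)[_].
  by rewrite /= /e stE.
have [j|j [i Ci]] := bar e.
  by have := nxP (st j); rewrite stE => /(_ (badst j))[+ _]; rewrite /e stE.
by apply: (badst j); exists 0%N, i.+1 => N _ w _; exists i => //; exact: Ccat.
Qed.

Lemma powR_addl_le (R : realType) (x y t : R) : 0 <= x -> 0 <= y -> 0 <= t ->
  (x + y) `^ t <= 2 `^ t * (x `^ t + y `^ t).
Proof.
move=> x0 y0 t0; have le2 z : 0 <= z -> x + y <= 2 * z -> (x + y) `^ t <= 2 `^ t * z `^ t.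
  move=> z0 xyz; rewrite -powRM//.
  by apply: ge0_ler_powR; rewrite // nnegrE ?addr_ge0 ?mulr_ge0.
have [xy|/ltW yx] := leP x y.
  apply: le_trans (le2 y y0 _) _; first lra.
  by rewrite ler_pM2l ?powR_gt0// lerDr powR_ge0.
apply: le_trans (le2 x x0 _) _; first lra.
by rewrite ler_pM2l ?powR_gt0// lerDl powR_ge0.
Qed.

Section LowerBound.
Variables (R : realType) (d : nat).
Variables (X : set 'rV[R]_d) (phi : nat -> 'rV[R]_d -> 'rV[R]_d) (x0 : 'rV[R]_d).
Variables (a : seq nat -> R) (K eta C c : R).
Hypothesis (cs : coded_system X phi x0 a K eta C c).

(** Mass distribution without a limit measure: the sets of a cheap cover are thickened, and by
    [finite_bar] each piece of a deep level lies in one of finitely many of them. The mass 1 of that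
    level would then be at most 1/2. *)
Lemma hausdorff_measure_J_dense_neq0 (t : R) (n : nat) (F : seq (seq nat)) :
  0 < t -> (0 < n)%N -> uniq F -> (forall w, w \in F -> size w = n) ->
  4 * K `^ t <= \sum_(w <- F) a w `^ t ->
  hausdorff_measure t (J_dense X phi) <> 0%E.
Proof.
move=> t0 n0 uF sF FZ.
(* The trailing 0 makes every insertion nonempty; density only needs each word to be a prefix of
   some insertion. *)
pose u k := rcons (odflt [::] (pickle_inv k : option (seq nat))) 0%N.
have u0 k : u k <> [::] by rewrite /u; case: (odflt _ _).
have [E [p [M [E0 Eu [p0 p1] M0 massM]]]] := mass_bound cs t0 n0 uF sF FZ u0.
move=> /hausdorff_measure_eq0P /(_ 1 ltr01) pre0.
(* Makes the final bound 1/2: one [eps] pays for the diameters, another for the added [z i]. *)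
pose eps := (4 * (M * 2 `^ t))^-1.
have M2 : 0 < M * 2 `^ t by rewrite mulr_gt0// powR_gt0.
have eps0 : 0 < eps by rewrite invr_gt0 mulr_gt0.
have : (hausdorff_pre t 1 (J_dense X phi) < eps%:E)%E.
  by apply: le_lt_trans pre0 _; rewrite lte_fin.
move=> /ereal_inf_lt[_ [U [JU U1] <-] Ueps].
have Um m : \sum_(i < m) ediam (U i) `^ t <= eps.
  rewrite -lee_fin -sumEFin; apply: le_trans (ltW Ueps).
  rewrite -(big_mkord xpredT (fun i => (ediam (U i) `^ t)%:E)).
  by apply: nneseries_lim_ge => i _; rewrite lee_fin powR_ge0.
(* Since [ediam (U i)] may be 0, a positive [z i] is added to leave room for a whole piece around a
   point of [U i]. *)
pose z i := (eps * 2^-1 ^+ i.+1) `^ t^-1.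
have z0 i : 0 < z i by rewrite powR_gt0// mulr_gt0// exprn_gt0// invr_gt0.
have zt i : z i `^ t = eps * 2^-1 ^+ i.+1.
  by rewrite /z -powRrM mulVf ?gt_eqF// powRr1// mulr_ge0 ?(ltW eps0)// exprn_ge0.
pose r i := ediam (U i) + z i.
have r0 i : 0 < r i by rewrite ltr_wpDl ?ediam_ge0.
pose U' i := [set y | exists2 x, U i x & enorm (y - x) < r i].
have U'r i : diam_le (U' i) (3 * r i).
  move=> y y' [x Ux yx] [x' Ux' y'x'].
  have xx' : enorm (x - x') <= r i.
    by apply: le_trans (enorm_le_ediam (U1 i) Ux Ux') _; rewrite lerDl ltW.
  have := ler_enorm_dist y x y'; have := ler_enorm_dist x x' y'.
  by rewrite (enormC x' y'); lra.
have [[[eta0 eta1] aeta] C0] := (coded_eta0 cs, coded_eta1 cs, coded_contract cs, coded_C0 cs).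
have eta01 : 0 <= eta < 1 by rewrite ltW.
pose Cov i w := word_comp phi w @` X `<=` U' i.
have [|e eE|N0 [m mP]] := @finite_bar E Cov.
- move=> i w w' Cw _ [x Xx <-]; apply: Cw; exists (word_comp phi w' x).
    exact: (coded_stable cs).
  by apply: esym; exact: word_comp_cat.
(* Any path of blocks contains all insertions, so it codes a point of [J_dense]; some [U i] contains
   this point, and a deep enough piece around it fits into [U' i]. *)
- have e0 j : e j <> [::] by exact: E0.
  have ew w : exists j w', e j = w ++ w'.
    have [j Ej] := Eu (pickle w); exists j, [:: 0%N].
    by have := eE j; rewrite Ej inE /u pickleK_inv /= cats1 => /eqP.
  have [x Jx xj] := dense_code_point cs e0 ew.
  have [i _ Uix] := JU x Jx.
  have C2 : 0 < 2 * C by rewrite mulr_gt0.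
  have [k kP] := small_expr eta01 (divr_gt0 (r0 i) C2).
  exists k, i => _ [y Xy <-]; exists x => //.
  have [x' Xx' <-] := xj k; apply: le_lt_trans (coded_diam cs _ Xy Xx') _.
  have := kP _ (size_concat e0 k); have := aeta (concat e k).
  move=> h1 h2; have {h1 h2} h := le_trans h1 h2.
  rewrite ler_pdivlMr// in h.
  by have := r0 i; lra.
have small i : {k | forall n, (k <= n)%N -> eta ^+ n <= r i}.
  by apply: cid; exact: small_expr.
(* Deep enough for the bar and for [a w] to be at most each of the finitely many [r i], as [massM]
   asks. *)
pose N := maxn N0 (\max_(i < m) projT1 (small i)).
have : 1 <= \sum_(i < m) M * r i `^ t.
  rewrite -(integ_cst p1 0 N 1 [::]).
  apply: (@le_trans _ _ (integ E p 0 N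
      (fun w => \sum_(i < m) (meets X phi (U' i) w)%:R) [::])).
    apply: integ_le => // w wl.
    have [i im Ci] := mP N (leq_maxl _ _) w wl.
    rewrite (bigD1 (Ordinal im))//= (_ : meets _ _ _ _ = true) ?lerDl ?sumr_ge0//.
    apply/asboolP; exists (word_comp phi w x0).
    have wX : (word_comp phi w @` X) (word_comp phi w x0).
      by exists x0 => //; exact: (coded_base cs).
    by split=> //; exact: Ci.
  rewrite (integ_sum E p 0 N m (fun i w => (meets X phi (U' i) w)%:R)).
  apply: ler_sum => i _; apply: massM => // w wl.
  apply: le_trans (aeta w) _; apply: (projT2 (small i)).
  apply: leq_trans (size_level E0 wl); rewrite leq_max; apply/orP; right.
  exact: (leq_bigmax (F := fun i : 'I_m => projT1 (small i))).
apply/negP; rewrite -ltNge -mulr_sumr.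
have geo k : \sum_(i < k) (2^-1 : R) ^+ i.+1 = 1 - 2^-1 ^+ k.
  elim: k => [|k IH]; first by rewrite big_ord0 expr0 subrr.
  by rewrite big_ord_recr/= IH exprS; field.
have rsum : \sum_(i < m) r i `^ t <= 2 `^ t * (eps + eps).
  apply: (@le_trans _ _ (\sum_(i < m) 2 `^ t * (ediam (U i) `^ t + z i `^ t))).
    by apply: ler_sum => i _; apply: powR_addl_le; rewrite ?ediam_ge0 ?ltW.
  rewrite -mulr_sumr ler_pM2l ?powR_gt0// big_split/=; apply: lerD; first exact: Um.
  under eq_bigr do rewrite zt.
  by rewrite -mulr_sumr geo ler_piMr ?(ltW eps0)// lerBlDr lerDl exprn_ge0// invr_ge0.
apply: le_lt_trans (ler_wpM2l (ltW M0) rsum) _.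
have -> : M * (2 `^ t * (eps + eps)) = 2^-1.
  by rewrite /eps; field; rewrite !gt_eqF// powR_gt0.
by rewrite invf_lt1 ?ltr1n.
Qed.

End LowerBound.

Theorem theorem11p1 (R : realType) (d : nat) (X : set 'rV[R]_d)
  (phi : nat -> 'rV[R]_d -> 'rV[R]_d) :
  CIFS X phi ->
  hausdorff_dim (J_dense X phi) = hausdorff_dim (limit_set X phi).
Proof.
move=> Xphi; apply/eqP; rewrite eq_le; apply/andP; split.
  apply: hausdorff_dim_le => x [om _ xom] n.
  by exists [seq om i | i <- iota 0 n]; [rewrite size_map size_iota|exact: xom].
have [X0|/set0P Xn0] := eqVneq X set0.
  by apply: hausdorff_dim_le => x /(_ 0%N)[w _ [y]]; rewrite X0.
have [x0 [a [K [eta [C [c cs]]]]]] := CIFS_coded_system Xphi Xn0.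
(* At this [t], [J_dense] is null although [t] is below the dimension of the limit set. A finite
   family with large sum contradicts the former; its absence bounds all sums and contradicts the
   latter. *)
rewrite leNgt; apply/negP => /ereal_inf_lt[_ [t [t_ge0 Jt] <-]] tL.
have t0 : 0 < t.
  rewrite lt_neqAle t_ge0 andbT eq_sym; apply/eqP => tE.
  by move: Jt; rewrite tE; exact: hausdorff_measure_exponent0.
have [[n [F [n0 uF sF FZ]]]|noF] := pselect (exists n (F : seq (seq nat)),
    [/\ (0 < n)%N, uniq F, forall w, w \in F -> size w = n &
    4 * K `^ t <= \sum_(w <- F) a w `^ t]).
  exact: (hausdorff_measure_J_dense_neq0 cs t0 n0 uF sF FZ Jt).
move: tL; apply/negP; rewrite -leNgt.
apply: (limit_set_dim_le cs (B := 4 * K `^ t) t0) => n F n0 uF sF.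
by rewrite leNgt; apply/negP => /ltW FZ; apply: noF; exists n, F.
Qed.
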